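(* (GBC) The principle of determinacy for clopen class games of rank at most $\mathrm{Ord}+1$ implies the existence of a truth predicate for $\mathcal L_{\mathrm{Ord},\omega}(\in,A)$ for any class parameter $A$.
   Context: A clopen class game is played on a well-founded class tree $T\subseteq V^{<\omega}$ whose terminal nodes are labeled as a win for player I or II: starting at the root the players alternately choose a child of the current node until a terminal node is reached, whose label determines the winner. $T$ has rank at most $\mathrm{Ord}+1$ if the root can be labeled $\mathrm{Ord}$ and every other node an ordinal so that each child has strictly smaller label than its parent. Determinacy: one player has a winning strategy (a choice of child at each of that player's nodes such that all conforming plays are wins for that player). $\mathcal L_{\mathrm{Ord},\omega}(\in,\hat A)$: formulas built from $x=y$, $x\in y$, $x\in\hat A$ by negation, set-sized conjunctions with finitely many free variables in total, and universal quantifiers. A truth predicate for it is a class $\mathbb T$ of pairs $\langle\varphi,\vec a\rangle$ ($\vec a$ a valuation) with: $\mathbb T(x=y,\langle a,b\rangle)$ iff $a=b$; $\mathbb T(x\in y,\langle a,b\rangle)$ iff $a\in b$; $\mathbb T(x\in\hat A,a)$ iff $a\in A$; $\mathbb T(\bigwedge_i\varphi_i,\vec a)$ iff all $\mathbb T(\varphi_i,\vec a)$; $\mathbb T(\neg\varphi,\vec a)$ iff not $\mathbb T(\varphi,\vec a)$; $\mathbb T(\forall x\varphi,\vec a)$ iff $\mathbb T(\varphi,b^\frown\vec a)$ for all $b$. *)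

(* Defs.v *)
(* A theorem of GBC is stated as: it holds in every model of GBC.  All the
   set-theoretic notions (omega, ordinals, finite sequences, trees, formulas of
   the infinitary language, ...) are interpreted inside the model: quantifiers
   range over its sets and its classes only.  In particular the natural numbers
   and the infinitary formulas are those of the model, which need not be
   standard. *)

Set Implicit Arguments.
Unset Strict Implicit.

Record class_structure := ClassStructure {
  V : Type;
  C : Type;
  mem : V -> V -> Prop;
  cmem : V -> C -> Prop
}.

Declare Scope gbc_scope.
Delimit Scope gbc_scope with gbc.
Notation "x ∈ y" := (mem x y) (at level 70) : gbc_scope.
Notation "x ∈c X" := (cmem x X) (at level 70) : gbc_scope.
Open Scope gbc_scope.

Definition subset {M : class_structure} (x y : V M) : Prop :=
  forall z, z ∈ x -> z ∈ y.

Definition is_empty {M : class_structure} (x : V M) : Prop :=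
  forall z, ~ z ∈ x.

Definition is_upair {M : class_structure} (p a b : V M) : Prop :=
  forall z, z ∈ p <-> z = a \/ z = b.

(* Kuratowski pair: p = {{a}, {a, b}}. *)
Definition is_opair {M : class_structure} (p a b : V M) : Prop :=
  exists u v, is_upair u a a /\ is_upair v a b /\ is_upair p u v.

(* y = x ∪ {a} *)
Definition is_adjoin {M : class_structure} (y x a : V M) : Prop :=
  forall z, z ∈ y <-> z ∈ x \/ z = a.

Definition is_succ {M : class_structure} (y x : V M) : Prop :=
  is_adjoin y x x.

Definition cpair {M : class_structure} (X : C M) (a b : V M) : Prop :=
  exists p, is_opair p a b /\ p ∈c X.

(* ** The axioms of GBC *)

(* First-order formulas with de Bruijn variables for sets, and classes only as
   parameters: no class quantifier. *)
Inductive fo (M : class_structure) : Type :=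
| FoEq : nat -> nat -> fo M
| FoMem : nat -> nat -> fo M
| FoIn : nat -> C M -> fo M
| FoNot : fo M -> fo M
| FoAnd : fo M -> fo M -> fo M
| FoAll : fo M -> fo M.

Definition scons {A : Type} (x : A) (e : nat -> A) (n : nat) : A :=
  match n with O => x | S m => e m end.

Fixpoint sat {M : class_structure} (e : nat -> V M) (phi : fo M) : Prop :=
  match phi with
  | FoEq _ i j => e i = e j
  | FoMem _ i j => e i ∈ e j
  | FoIn i X => e i ∈c X
  | FoNot phi1 => ~ sat e phi1
  | FoAnd phi1 phi2 => sat e phi1 /\ sat e phi2
  | FoAll phi1 => forall x, sat (scons x e) phi1
  end.

Definition single_valued {M : class_structure} (F : C M) : Prop :=
  forall x y z, cpair F x y -> cpair F x z -> y = z.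

(* Foundation and global choice are Goedel's axioms D and E. *)
Record GBC (M : class_structure) : Prop := {
  gbc_set_ext : forall x y : V M, (forall z, z ∈ x <-> z ∈ y) -> x = y;
  gbc_class_ext : forall X Y : C M, (forall z, z ∈c X <-> z ∈c Y) -> X = Y;
  gbc_comprehension : forall (phi : fo M) (e : nat -> V M),
    exists X : C M, forall x, x ∈c X <-> sat (scons x e) phi;
  gbc_pairing : forall a b : V M, exists p, is_upair p a b;
  gbc_union : forall a : V M,
    exists u, forall z, z ∈ u <-> exists y, z ∈ y /\ y ∈ a;
  gbc_power : forall a : V M, exists p, forall z, z ∈ p <-> subset z a;
  gbc_infinity : exists w : V M,
    (exists z, is_empty z /\ z ∈ w) /\
    (forall x, x ∈ w -> exists y, is_succ y x /\ y ∈ w);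
  gbc_replacement : forall (F : C M) (a : V M), single_valued F ->
    exists b, forall y, y ∈ b <-> exists x, x ∈ a /\ cpair F x y;
  gbc_foundation : forall X : C M, (exists x, x ∈c X) ->
    exists x, x ∈c X /\ forall y, y ∈ x -> ~ y ∈c X;
  gbc_global_choice : exists F : C M, forall x : V M, ~ is_empty x ->
    exists y, y ∈ x /\ forall z, cpair F x z <-> z = y
}.

(* ** Ordinals, natural numbers, functions, finite sequences *)

Definition is_ord {M : class_structure} (a : V M) : Prop :=
  (forall x, x ∈ a -> subset x a) /\
  (forall x y, x ∈ a -> y ∈ a -> x ∈ y \/ x = y \/ y ∈ x).

Definition is_nat {M : class_structure} (n : V M) : Prop :=
  is_ord n /\
  forall m, m ∈ n \/ m = n -> is_empty m \/ exists k, is_succ m k.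

(* x is the von Neumann numeral of the standard number k *)
Fixpoint is_num {M : class_structure} (k : nat) (x : V M) : Prop :=
  match k with
  | O => is_empty x
  | S j => exists y, is_num j y /\ is_succ x y
  end.

Definition app {M : class_structure} (f x y : V M) : Prop :=
  exists p, is_opair p x y /\ p ∈ f.

Definition is_fun {M : class_structure} (f : V M) : Prop :=
  (forall p, p ∈ f -> exists x y, is_opair p x y) /\
  (forall x y z, app f x y -> app f x z -> y = z).

Definition is_fun_on {M : class_structure} (f d : V M) : Prop :=
  is_fun f /\ forall x, x ∈ d <-> exists y, app f x y.

(* d is finite: there is a bijection from a natural number onto d *)
Definition is_finite {M : class_structure} (d : V M) : Prop :=
  exists n f, is_nat n /\ is_fun_on f n /\
    (forall x x' y, app f x y -> app f x' y -> x = x') /\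
    (forall y, y ∈ d <-> exists x, app f x y).

(* finite sequence of length n; for finite sequences, "initial segment of" is
   [subset] *)
Definition is_seq {M : class_structure} (s n : V M) : Prop :=
  is_nat n /\ is_fun_on s n.

(* ** Clopen class games *)

(* s' extends the finite sequence s by exactly one term *)
Definition extends1 {M : class_structure} (s s' : V M) : Prop :=
  exists n n', is_seq s n /\ is_seq s' n' /\ is_succ n' n /\ subset s s'.

Definition is_tree {M : class_structure} (T : C M) : Prop :=
  (forall s, s ∈c T -> exists n, is_seq s n) /\
  (exists s, is_empty s /\ s ∈c T) /\
  (forall s n t, t ∈c T -> is_seq s n -> subset s t -> s ∈c T).

Definition is_child {M : class_structure} (T : C M) (s s' : V M) : Prop :=
  s ∈c T /\ s' ∈c T /\ extends1 s s'.

Definition is_terminal {M : class_structure} (T : C M) (t : V M) : Prop :=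
  t ∈c T /\ ~ exists t', is_child T t t'.

(* By replacement an infinite branch is a set, namely a function on omega. *)
Definition infinite_branch {M : class_structure} (T : C M) (f : V M) : Prop :=
  is_fun f /\
  (forall n, is_nat n <-> exists y, app f n y) /\
  (forall s n, is_seq s n -> subset s f -> s ∈c T).

Definition well_founded_tree {M : class_structure} (T : C M) : Prop :=
  is_tree T /\ ~ exists f, infinite_branch T f.

(* R is a class function labelling the non-root nodes with ordinals that
   strictly decrease from parent to child.  The label Ord of the root is a
   proper class, hence left implicit: it exceeds all the other labels. *)
Definition rank_at_most_Ord_plus_1 {M : class_structure} (T : C M) : Prop :=
  exists R : C M,
    (forall s, s ∈c T -> ~ is_empty s ->
       exists a, is_ord a /\ forall b, cpair R s b <-> b = a) /\
    (forall s s' a a', is_child T s s' -> ~ is_empty s ->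
       cpair R s a -> cpair R s' a' -> a' ∈ a).

Inductive player := I | II.

(* e witnesses that n is even: 0 ∈ e, and membership in e alternates below n *)
Definition is_even {M : class_structure} (n : V M) : Prop :=
  exists e, (forall z, is_empty z -> z ∈ e) /\
    (forall k k', k ∈ n -> is_succ k' k -> (k' ∈ e <-> ~ k ∈ e)) /\
    n ∈ e.

(* I moves at the nodes of even length, among them the root *)
Definition to_move {M : class_structure} (p : player) (s : V M) : Prop :=
  exists n, is_seq s n /\
    match p with I => is_even n | II => ~ is_even n end.

(* The labelling of the terminal nodes is given by a class W: those in W are a
   win for I, the others a win for II. *)
Definition is_win {M : class_structure} (W : C M) (p : player) (t : V M) : Prop :=
  match p with I => t ∈c W | II => ~ t ∈c W end.

Definition is_strategy {M : class_structure} (T : C M) (p : player) (S : C M) : Prop :=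
  forall s, s ∈c T -> ~ is_terminal T s -> to_move p s ->
    exists s', is_child T s s' /\ forall u, cpair S s u <-> u = s'.

(* the play that ends in the node t conforms to p's strategy S *)
Definition conforms {M : class_structure} (T : C M) (p : player) (S : C M) (t : V M) : Prop :=
  forall s s', is_child T s s' -> subset s' t -> to_move p s -> cpair S s s'.

Definition is_winning {M : class_structure} (T W : C M) (p : player) (S : C M) : Prop :=
  is_strategy T p S /\
  forall t, is_terminal T t -> conforms T p S t -> is_win W p t.

Definition determined {M : class_structure} (T W : C M) : Prop :=
  exists p S, is_winning T W p S.

Definition clopen_determinacy_rank_Ord_plus_1 (M : class_structure) : Prop :=
  forall T W : C M,
    well_founded_tree T -> rank_at_most_Ord_plus_1 T -> determined T W.

(* ** The language L_{Ord,omega}(∈, Â) *)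

(* The variables are v_α for α an ordinal, coded by α.  Formulas are coded by
     v_x = v_y  as (0,(x,y)),   v_x ∈ v_y  as (1,(x,y)),   v_x ∈ Â  as (2,x),
     ¬ψ  as (3,ψ),   ⋀Φ (Φ a set of formulas)  as (4,Φ),
     ∀v_x ψ  as (5,(x,ψ)). *)
Definition tagged {M : class_structure} (k : nat) (phi c : V M) : Prop :=
  exists t, is_num k t /\ is_opair phi t c.

Definition tagged2 {M : class_structure} (k : nat) (phi a b : V M) : Prop :=
  exists c, is_opair c a b /\ tagged k phi c.

Definition is_eq_fml {M : class_structure} (phi x y : V M) := tagged2 0 phi x y.
Definition is_mem_fml {M : class_structure} (phi x y : V M) := tagged2 1 phi x y.
Definition is_in_fml {M : class_structure} (phi x : V M) := tagged 2 phi x.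
Definition is_neg_fml {M : class_structure} (phi psi : V M) := tagged 3 phi psi.
Definition is_conj_fml {M : class_structure} (phi Phi : V M) := tagged 4 phi Phi.
Definition is_all_fml {M : class_structure} (phi x psi : V M) := tagged2 5 phi x psi.

Definition is_context {M : class_structure} (d : V M) : Prop :=
  is_finite d /\ forall x, x ∈ d -> is_ord x.

(* The one-step formation rule for "phi is a formula whose free variables are
   all in d", the immediate subformulas being looked up in S. *)
Definition formation {M : class_structure} (S phi d : V M) : Prop :=
  (exists x y, x ∈ d /\ y ∈ d /\ is_eq_fml phi x y) \/
  (exists x y, x ∈ d /\ y ∈ d /\ is_mem_fml phi x y) \/
  (exists x, x ∈ d /\ is_in_fml phi x) \/
  (exists psi, is_neg_fml phi psi /\ app S psi d) \/
  (exists Phi, is_conj_fml phi Phi /\ forall psi, psi ∈ Phi -> app S psi d) \/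
  (exists x psi d', is_all_fml phi x psi /\ is_adjoin d' d x /\ is_context d' /\
     app S psi d').

(* phi is a formula and d is a finite set of variables that contains its free
   variables: this is witnessed by a set S of such pairs closed under immediate
   subformulas.  Derivations are well-founded by foundation.  As d is finite, a
   conjunction has only finitely many free variables in total. *)
Definition is_formula {M : class_structure} (phi d : V M) : Prop :=
  is_context d /\
  exists S, app S phi d /\ forall psi e, app S psi e -> formation S psi e.

(* ** Truth predicates *)

(* a' is the valuation a changed to take the value b at v_x *)
Definition is_update {M : class_structure} (a' a x b : V M) : Prop :=
  is_fun a' /\
  forall y c, app a' y c <-> (y = x /\ c = b) \/ (y <> x /\ app a y c).

(* A valuation is a function on a finite set of variables that contains the
   free variables of the formula. *)
Definition is_truth_predicate {M : class_structure} (A T : C M) : Prop :=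
  (forall p, p ∈c T ->
     exists phi a d, is_opair p phi a /\ is_formula phi d /\ is_fun_on a d) /\
  (forall phi a d, is_formula phi d -> is_fun_on a d ->
     (forall x y u v, is_eq_fml phi x y -> app a x u -> app a y v ->
        (cpair T phi a <-> u = v)) /\
     (forall x y u v, is_mem_fml phi x y -> app a x u -> app a y v ->
        (cpair T phi a <-> u ∈ v)) /\
     (forall x u, is_in_fml phi x -> app a x u ->
        (cpair T phi a <-> u ∈c A)) /\
     (forall psi, is_neg_fml phi psi ->
        (cpair T phi a <-> ~ cpair T psi a)) /\
     (forall Phi, is_conj_fml phi Phi ->
        (cpair T phi a <-> forall psi, psi ∈ Phi -> cpair T psi a)) /\
     (forall x psi, is_all_fml phi x psi ->
        (cpair T phi a <->
         forall b a', is_update a' a x b -> cpair T psi a'))).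

(* Main.v *)
(* A player opens with a formula and a valuation, his opponent says whether it
   is true, and then they play the evaluation game in which the falsifier picks
   subformulas and instances.  Its rank is bounded by the rank of the formula,
   so the whole game has rank at most Ord + 1.  Two positions about the same
   formula in which the owner of a winning strategy has opposite roles cannot
   both be reached: playing the strategy against itself from there would end
   in an atom won by both sides.  Hence the opener has no winning strategy, and
   the answers of a winning strategy of the other player obey Tarski's clauses. *)

From Stdlib Require Import Classical ClassicalEpsilon.
Require Import Defs.

Set Implicit Arguments.
Unset Strict Implicit.

(** The answers of a strategy depend on the history of the play, while comprehension admits no class
    quantifiers. Truth is therefore read off from reachability: whether some conforming play, a
    finite sequence and hence a set, ends at a formula with a given player to move. With the
    strategy as a class parameter this is first-order, and the exclusion of opposite roles makes the
    result independent of the play that reaches the formula. The same restriction governs every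
    induction inside the model, because foundation applies to classes only: each predicate has to be
    shown definable, and most of these proofs are left to a tactic. The game is the unfolding of a
    graph of states labelled by von Neumann ranks. Every label is an ordinal, but the opening move
    may choose a formula of any rank, so the root needs the label Ord. *)

Section Development.

Context (M : class_structure) (G : GBC M).

Notation env := (nat -> V M).

(** * First-order definability *)

(** Predicates of a whole environment turn a binder into a shift: the bound variable is [e 0] and
    the outer environment is [fun n => e (S n)]. Connectives can then be combined without writing
    out formulas. *)
Definition definable (P : env -> Prop) : Prop :=
  exists phi : fo M, forall e, sat e phi <-> P e.

(* A term in the variables of [e] counts as definable when its graph is; the
   value of the term is the variable 0 of the graph. *)
Definition dterm (t : env -> V M) : Prop :=
  definable (fun e => e 0 = t (fun n => e (S n))).

Lemma definable_ext (P Q : env -> Prop) :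
  (forall e, P e <-> Q e) -> definable P -> definable Q.
Proof.
  intros H [phi Hphi]. exists phi. intro e. rewrite Hphi. apply H.
Qed.

Lemma definable_not (P : env -> Prop) :
  definable P -> definable (fun e => ~ P e).
Proof.
  intros [phi H]. exists (FoNot phi). intro e. simpl. rewrite H. tauto.
Qed.

Lemma definable_and (P Q : env -> Prop) :
  definable P -> definable Q -> definable (fun e => P e /\ Q e).
Proof.
  intros [phi H] [psi K]. exists (FoAnd phi psi). intro e. simpl.
  rewrite H, K. tauto.
Qed.

Lemma definable_all (Q : V M -> env -> Prop) :
  definable (fun e => Q (e 0) (fun n => e (S n))) ->
  definable (fun e => forall x, Q x e).
Proof.
  intros [phi H]. exists (FoAll phi). intro e.
  split; intros K x; apply (H (scons x e)); apply K.
Qed.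

Lemma definable_or (P Q : env -> Prop) :
  definable P -> definable Q -> definable (fun e => P e \/ Q e).
Proof.
  intros HP HQ. apply definable_ext with (fun e => ~ (~ P e /\ ~ Q e)).
  - intro e. tauto.
  - apply definable_not, definable_and; apply definable_not; assumption.
Qed.

Lemma definable_imp (P Q : env -> Prop) :
  definable P -> definable Q -> definable (fun e => P e -> Q e).
Proof.
  intros HP HQ. apply definable_ext with (fun e => ~ P e \/ Q e).
  - intro e. tauto.
  - apply definable_or; [apply definable_not|]; assumption.
Qed.

Lemma definable_iff (P Q : env -> Prop) :
  definable P -> definable Q -> definable (fun e => P e <-> Q e).
Proof.
  intros HP HQ. apply definable_and; apply definable_imp; assumption.
Qed.

Lemma definable_ex (Q : V M -> env -> Prop) :
  definable (fun e => Q (e 0) (fun n => e (S n))) ->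
  definable (fun e => exists x, Q x e).
Proof.
  intro H. apply definable_ext with (fun e => ~ forall x, ~ Q x e).
  - intro e. split.
    + intro K. apply not_all_not_ex. exact K.
    + intros [x Hx] K. exact (K x Hx).
  - apply definable_not.
    apply (definable_all (Q := fun x e => ~ Q x e)).
    apply (definable_not H).
Qed.

Fixpoint rename (r : nat -> nat) (phi : fo M) : fo M :=
  match phi with
  | FoEq _ i j => FoEq M (r i) (r j)
  | FoMem _ i j => FoMem M (r i) (r j)
  | FoIn i X => FoIn (r i) X
  | FoNot phi1 => FoNot (rename r phi1)
  | FoAnd phi1 phi2 => FoAnd (rename r phi1) (rename r phi2)
  | FoAll phi1 =>
      FoAll (rename (fun n => match n with O => O | S m => S (r m) end) phi1)
  end.

Lemma sat_rename (phi : fo M) :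
  forall (r : nat -> nat) (e e' : env), (forall n, e' n = e (r n)) ->
    (sat e (rename r phi) <-> sat e' phi).
Proof.
  induction phi as [i j|i j|i X|phi IH|phi1 IH1 phi2 IH2|phi IH];
    intros r e e' H; simpl.
  - rewrite !H. tauto.
  - rewrite !H. tauto.
  - rewrite !H. tauto.
  - rewrite (IH r e e' H). tauto.
  - rewrite (IH1 r e e' H), (IH2 r e e' H). tauto.
  - assert (K : forall x n, scons x e' n =
      scons x e (match n with O => O | S m => S (r m) end))
      by (intros x [|n]; simpl; auto).
    split; intros L x; apply (IH _ _ _ (K x)); apply L.
Qed.

Lemma definable_rename (P : env -> Prop) (r : nat -> nat) :
  definable P -> definable (fun e => P (fun n => e (r n))).
Proof.
  intros [phi H]. exists (rename r phi). intro e. rewrite <- H.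
  apply sat_rename. reflexivity.
Qed.

Lemma dterm_rename (t : env -> V M) (r : nat -> nat) :
  dterm t -> dterm (fun e => t (fun n => e (r n))).
Proof.
  intro H.
  exact (definable_rename
    (fun n => match n with O => O | S m => S (r m) end) H).
Qed.

(** Terms have graphs but no syntax, so substitution is expressed by an existential quantifier over
    the value of [t]. *)
Lemma definable_subst (Q : V M -> env -> Prop) (t : env -> V M) :
  dterm t -> definable (fun e => Q (e 0) (fun n => e (S n))) ->
  definable (fun e => Q (t e) e).
Proof.
  intros Ht HQ.
  apply definable_ext with (fun e => exists x, x = t e /\ Q x e).
  - intro e. split.
    + intros [x [-> H]]. exact H.
    + intro H. exists (t e). auto.
  - apply (definable_ex (Q := fun x e => x = t e /\ Q x e)).
    apply definable_and; assumption.
Qed.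

Lemma definable_subst1 (Q : V M -> Prop) (t : env -> V M) :
  definable (fun e => Q (e 0)) -> dterm t -> definable (fun e => Q (t e)).
Proof.
  intros HQ Ht. exact (definable_subst (Q := fun x _ => Q x) Ht HQ).
Qed.

Lemma definable_subst2 (Q : V M -> V M -> Prop) (t u : env -> V M) :
  definable (fun e => Q (e 0) (e 1)) -> dterm t -> dterm u ->
  definable (fun e => Q (t e) (u e)).
Proof.
  intros HQ Ht Hu.
  apply (definable_subst (Q := fun x e => Q x (u e)) Ht).
  apply (definable_subst (Q := fun y e => Q (e 0) y)
    (t := fun e => u (fun n => e (S n)))).
  - exact (dterm_rename S Hu).
  - exact (definable_rename
      (fun n => match n with O => 1 | S O => 0 | k => k end) HQ).
Qed.

Lemma definable_subst3 (Q : V M -> V M -> V M -> Prop) (t u v : env -> V M) :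
  definable (fun e => Q (e 0) (e 1) (e 2)) -> dterm t -> dterm u -> dterm v ->
  definable (fun e => Q (t e) (u e) (v e)).
Proof.
  intros HQ Ht Hu Hv.
  apply (definable_subst (Q := fun x e => Q x (u e) (v e)) Ht).
  apply (definable_subst (Q := fun y e => Q (e 0) y (v (fun n => e (S n))))
    (t := fun e => u (fun n => e (S n)))).
  - exact (dterm_rename S Hu).
  - apply (definable_subst (Q := fun z e => Q (e 1) (e 0) z)
      (t := fun e => v (fun n => e (S (S n))))).
    + exact (dterm_rename (fun n => S (S n)) Hv).
    + exact (definable_rename
        (fun n => match n with O => 2 | S O => 1 | S (S O) => 0 | k => k end)
        HQ).
Qed.

Lemma dterm_var (k : nat) : dterm (fun e => e k).
Proof.
  exists (FoEq M 0 (S k)). intro e. simpl. tauto.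
Qed.

Lemma definable_eq (t u : env -> V M) :
  dterm t -> dterm u -> definable (fun e => t e = u e).
Proof.
  apply (definable_subst2 (Q := fun x y => x = y)).
  exists (FoEq M 0 1). intro e. simpl. tauto.
Qed.

Lemma definable_mem (t u : env -> V M) :
  dterm t -> dterm u -> definable (fun e => t e ∈ u e).
Proof.
  apply (definable_subst2 (Q := fun x y => x ∈ y)).
  exists (FoMem M 0 1). intro e. simpl. tauto.
Qed.

Lemma definable_cmem (t : env -> V M) (X : C M) :
  dterm t -> definable (fun e => t e ∈c X).
Proof.
  apply (definable_subst1 (Q := fun x => x ∈c X)).
  exists (FoIn 0 X). intro e. simpl. tauto.
Qed.

(** Formulas carry class parameters but no set parameters; the constant enters as the class of its
    members, and extensionality pins it down. *)
Lemma dterm_const (c : V M) : dterm (fun _ => c).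
Proof.
  destruct (gbc_comprehension G (FoMem M 0 1) (fun _ => c)) as [X HX].
  apply definable_ext with (fun e => forall z, z ∈ e 0 <-> z ∈c X).
  - intro e. split.
    + intro H. apply (gbc_set_ext G). intro z. rewrite (H z), (HX z).
      simpl. tauto.
    + intros H z. rewrite H, (HX z). simpl. tauto.
  - apply (definable_all (Q := fun z e => z ∈ e 0 <-> z ∈c X)).
    apply definable_iff.
    + apply definable_mem; apply dterm_var.
    + apply definable_cmem, dterm_var.
Qed.

(** Excluded middle settles [P] in the metatheory, so a true or a false formula can be chosen for
    it. *)
Lemma definable_const (P : Prop) : definable (fun _ => P).
Proof.
  destruct (classic P) as [HP|HP].
  - exists (FoAll (FoEq M 0 0)). simpl. split; auto.
  - exists (FoNot (FoAll (FoEq M 0 0))). simpl. split; [|contradiction].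
    intro H. destruct H. reflexivity.
Qed.

Lemma dterm_subst1 (f : V M -> V M) (t : env -> V M) :
  dterm (fun e => f (e 0)) -> dterm t -> dterm (fun e => f (t e)).
Proof.
  intros Hf Ht.
  apply (definable_subst2 (Q := fun x y => x = f y) Hf).
  - apply dterm_var.
  - exact (dterm_rename S Ht).
Qed.

Lemma dterm_subst2 (f : V M -> V M -> V M) (t u : env -> V M) :
  dterm (fun e => f (e 0) (e 1)) -> dterm t -> dterm u ->
  dterm (fun e => f (t e) (u e)).
Proof.
  intros Hf Ht Hu.
  apply (definable_subst3 (Q := fun x y z => x = f y z) Hf).
  - apply dterm_var.
  - exact (dterm_rename S Ht).
  - exact (dterm_rename S Hu).
Qed.

(* Redefined whenever a primitive function symbol becomes available. *)
Ltac dfn_defined := fail.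

Ltac unfold_head f :=
  match f with
  | ?g _ => unfold_head g
  | _ => unfold f
  end.

(** The order matters: hypotheses about abstract predicates and the primitive function symbols are
    tried before any head symbol is unfolded. *)
Ltac dfn_step :=
  cbv beta iota;
  match goal with
  | H : definable (fun e => ?P (e 0)) |- definable (fun e => ?P _) =>
      apply (definable_subst1 H)
  | H : definable (fun e => ?P (e 0) (e 1)) |- definable (fun e => ?P _ _) =>
      apply (definable_subst2 H)
  | H : dterm (fun e => ?f (e 0)) |- dterm (fun e => ?f _) =>
      apply (dterm_subst1 H)
  | |- dterm (fun e => e _) => apply dterm_var
  | |- dterm (fun _ => ?c) => apply (dterm_const c)
  | |- definable (fun _ => ?P) => apply (definable_const P)
  | |- definable (fun e => ~ _) => apply definable_not
  | |- definable (fun e => _ /\ _) => apply definable_and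
  | |- definable (fun e => _ \/ _) => apply definable_or
  | |- definable (fun e => _ <-> _) => apply definable_iff
  | |- definable (fun e => exists x, @?Q e x) =>
      apply (definable_ex (Q := fun x e => Q e x))
  | |- definable (fun e => _ = _) => apply definable_eq
  | |- definable (fun e => _ ∈ _) => apply definable_mem
  | |- definable (fun e => _ ∈c _) => apply definable_cmem
  | |- definable (fun e => @?P e -> @?Q e) =>
      apply (definable_imp (P := P) (Q := Q))
  | |- definable (fun e => forall x : V M, @?Q e x) =>
      apply (definable_all (Q := fun x e => Q e x))
  | |- _ => dfn_defined
  | |- definable (fun e => ?f _) => unfold_head f
  | |- definable (fun e => ?f _ _) => unfold_head f
  | |- definable (fun e => ?f _ _ _) => unfold_head f
  | |- definable (fun e => ?f _ _ _ _) => unfold_head f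
  | |- dterm (fun e => ?f _) => unfold_head f
  | |- dterm (fun e => ?f _ _) => unfold_head f
  | |- dterm (fun e => ?f _ _ _) => unfold_head f
  end.

Ltac dfn := repeat dfn_step.

(** * Basic set theory *)

Lemma class_of (P : V M -> Prop) :
  definable (fun e => P (e 0)) -> exists X : C M, forall x, x ∈c X <-> P x.
Proof.
  (* Infinity supplies a set [w] with which to fill the rest of the environment. *)
  intros [phi H]. destruct (gbc_infinity G) as [w _].
  destruct (gbc_comprehension G phi (fun _ => w)) as [X HX].
  exists X. intro x. rewrite HX. apply H.
Qed.

Lemma foundation (P : V M -> Prop) :
  definable (fun e => P (e 0)) -> (exists x, P x) ->
  exists x, P x /\ forall y, y ∈ x -> ~ P y.
Proof.
  intros HP [x Hx]. destruct (class_of HP) as [X HX].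
  destruct (gbc_foundation G (X := X)) as [y [Hy K]].
  - exists x. apply HX. exact Hx.
  - exists y. split.
    + apply HX. exact Hy.
    + intros z Hz L. apply (K z Hz), HX, L.
Qed.

Lemma mem_ind (P : V M -> Prop) :
  definable (fun e => P (e 0)) ->
  (forall x, (forall y, y ∈ x -> P y) -> P x) -> forall x, P x.
Proof.
  intros HP H x. apply NNPP. intro Hx.
  destruct (foundation (P := fun x => ~ P x)) as [y [Hy K]].
  - dfn.
  - exists x. exact Hx.
  - apply Hy, H. intros z Hz. apply NNPP. exact (K z Hz).
Qed.

Ltac mem_induction :=
  match goal with
  | |- forall x, @?P x => apply (mem_ind (P := P)); [dfn | cbv beta]
  end.

(** Choice in the metatheory: it names a witness outside the model, so the functions built from it
    still need their graphs shown definable. *)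
Definition the (P : V M -> Prop) (H : exists x, P x) : V M :=
  proj1_sig (constructive_indefinite_description P H).

Lemma theP (P : V M -> Prop) (H : exists x, P x) : P (the H).
Proof.
  exact (proj2_sig (constructive_indefinite_description P H)).
Qed.

(** * Pairs, unions, successors and numerals *)

Lemma empty_exists : exists x : V M, is_empty x.
Proof.
  destruct (gbc_infinity G) as [w [[z [Hz _]] _]]. exists z. exact Hz.
Qed.

Definition emp := the empty_exists.
Definition upair a b := the (gbc_pairing G a b).
Definition opair a b := upair (upair a a) (upair a b).
Definition union a := the (gbc_union G a).
Definition adjoin x a := union (upair x (upair a a)).
Definition succ x := adjoin x x.

Lemma in_emp (x : V M) : ~ x ∈ emp.
Proof. apply (theP empty_exists). Qed.

Lemma in_upair (a b x : V M) : x ∈ upair a b <-> x = a \/ x = b.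
Proof. apply (theP (gbc_pairing G a b)). Qed.

Lemma in_union (a x : V M) : x ∈ union a <-> exists y, x ∈ y /\ y ∈ a.
Proof. apply (theP (gbc_union G a)). Qed.

Lemma in_adjoin (x a z : V M) : z ∈ adjoin x a <-> z ∈ x \/ z = a.
Proof.
  unfold adjoin. rewrite in_union. split.
  - intros [y [Hz Hy]]. apply in_upair in Hy as [->| ->]; auto.
    apply in_upair in Hz. tauto.
  - intros [Hz|Hz].
    + exists x. rewrite in_upair. auto.
    + exists (upair a a). rewrite !in_upair. auto.
Qed.

Lemma in_succ (x z : V M) : z ∈ succ x <-> z ∈ x \/ z = x.
Proof. apply in_adjoin. Qed.

Lemma is_empty_iff (x : V M) : is_empty x <-> x = emp.
Proof.
  split.
  - intro H. apply (gbc_set_ext G). intro z. split; intro K.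
    + destruct (H z K).
    + destruct (in_emp K).
  - intros ->. exact in_emp.
Qed.

Lemma is_upair_iff (p a b : V M) : is_upair p a b <-> p = upair a b.
Proof.
  split.
  - intro H. apply (gbc_set_ext G). intro z. rewrite (H z), in_upair. tauto.
  - intros -> z. apply in_upair.
Qed.

Lemma is_opair_iff (p a b : V M) : is_opair p a b <-> p = opair a b.
Proof.
  split.
  - intros (u & v & Hu & Hv & Hp).
    apply is_upair_iff in Hu, Hv, Hp. subst. reflexivity.
  - intros ->. exists (upair a a), (upair a b).
    rewrite !is_upair_iff. auto.
Qed.

Lemma is_adjoin_iff (y x a : V M) : is_adjoin y x a <-> y = adjoin x a.
Proof.
  split.
  - intro H. apply (gbc_set_ext G). intro z. rewrite (H z), in_adjoin. tauto.
  - intros -> z. apply in_adjoin.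
Qed.

Lemma is_succ_iff (y x : V M) : is_succ y x <-> y = succ x.
Proof. apply is_adjoin_iff. Qed.

Lemma app_iff (f x y : V M) : app f x y <-> opair x y ∈ f.
Proof.
  split.
  - intros [p [Hp H]]. apply is_opair_iff in Hp as ->. exact H.
  - intro H. exists (opair x y). rewrite is_opair_iff. auto.
Qed.

Lemma cpair_iff (X : C M) (x y : V M) : cpair X x y <-> opair x y ∈c X.
Proof.
  split.
  - intros [p [Hp H]]. apply is_opair_iff in Hp as ->. exact H.
  - intro H. exists (opair x y). rewrite is_opair_iff. auto.
Qed.

Lemma upair_inj (a b c d : V M) :
  upair a b = upair c d -> a = c /\ b = d \/ a = d /\ b = c.
Proof.
  intro H.
  assert (K : forall x, x = a \/ x = b <-> x = c \/ x = d)
    by (intro x; rewrite <- !in_upair, H; tauto).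
  pose proof (proj1 (K a)). pose proof (proj1 (K b)).
  pose proof (proj2 (K c)). pose proof (proj2 (K d)).
  intuition congruence.
Qed.

Lemma opair_inj (a b c d : V M) : opair a b = opair c d -> a = c /\ b = d.
Proof.
  intro H. apply upair_inj in H as [[H K]|[H K]];
    apply upair_inj in H; apply upair_inj in K; intuition congruence.
Qed.

Lemma dterm_upair (t u : env -> V M) :
  dterm t -> dterm u -> dterm (fun e => upair (t e) (u e)).
Proof.
  apply dterm_subst2.
  apply definable_ext with (fun e => is_upair (e 0) (e 1) (e 2)).
  - intro e. apply is_upair_iff.
  - unfold is_upair. dfn.
Qed.

Lemma dterm_union (t : env -> V M) :
  dterm t -> dterm (fun e => union (t e)).
Proof.
  apply dterm_subst1.
  apply definable_ext with
    (fun e => forall z, z ∈ e 0 <-> exists y, z ∈ y /\ y ∈ e 1).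
  - intro e. split.
    + intro H. apply (gbc_set_ext G). intro z. rewrite H, in_union. tauto.
    + intros -> z. apply in_union.
  - dfn.
Qed.

Ltac dfn_defined ::=
  match goal with
  | |- dterm (fun e => upair _ _) => apply dterm_upair
  | |- dterm (fun e => union _) => apply dterm_union
  end.

Lemma replacement (F : V M -> V M -> Prop) (a : V M) :
  definable (fun e => F (e 0) (e 1)) ->
  (forall x y z, F x y -> F x z -> y = z) ->
  exists b, forall y, y ∈ b <-> exists x, x ∈ a /\ F x y.
Proof.
  intros HF HFun.
  destruct (class_of (P := fun p => exists x y, p = opair x y /\ F x y))
    as [X HX]; [dfn|].
  assert (K : forall x y, cpair X x y <-> F x y).
  { intros x y. rewrite cpair_iff, HX. split.
    - intros (x' & y' & H & H'). apply opair_inj in H as [-> ->]. exact H'.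
    - intro H. exists x, y. auto. }
  destruct (gbc_replacement G (F := X) a) as [b Hb].
  - intros x y z. rewrite !K. apply HFun.
  - exists b. intro y. rewrite Hb. split; intros [x Hx]; exists x;
      rewrite K in *; exact Hx.
Qed.

Lemma separation (P : V M -> Prop) (a : V M) :
  definable (fun e => P (e 0)) -> exists b, forall x, x ∈ b <-> x ∈ a /\ P x.
Proof.
  intro HP.
  destruct (replacement (F := fun x y => y = x /\ P x) a) as [b Hb].
  - dfn.
  - intros x y z [-> _] [-> _]. reflexivity.
  - exists b. intro x. rewrite Hb. split.
    + intros (y & Hy & -> & H). auto.
    + intros [H K]. exists x. auto.
Qed.

Lemma mem_irrefl (x : V M) : ~ x ∈ x.
Proof.
  intro H. destruct (foundation (P := fun y => y = x)) as [y [-> K]].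
  - dfn.
  - eauto.
  - exact (K x H eq_refl).
Qed.

Lemma mem_asym (x y : V M) : x ∈ y -> ~ y ∈ x.
Proof.
  intros H H'.
  destruct (foundation (P := fun z => z = x \/ z = y)) as [z [Hz K]].
  - dfn.
  - eauto.
  - destruct Hz as [->| ->].
    + exact (K y H' (or_intror eq_refl)).
    + exact (K x H (or_introl eq_refl)).
Qed.

Lemma mem_no_3cycle (x y z : V M) : x ∈ y -> y ∈ z -> ~ z ∈ x.
Proof.
  intros H H' H''.
  destruct (foundation (P := fun u => u = x \/ u = y \/ u = z))
    as [u [Hu K]].
  - dfn.
  - eauto.
  - destruct Hu as [->|[->| ->]].
    + exact (K z H'' (or_intror (or_intror eq_refl))).
    + exact (K x H (or_introl eq_refl)).
    + exact (K y H' (or_intror (or_introl eq_refl))).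
Qed.

Lemma succ_inj (x y : V M) : succ x = succ y -> x = y.
Proof.
  intro H.
  assert (Hx : x ∈ succ y) by (rewrite <- H, in_succ; auto).
  assert (Hy : y ∈ succ x) by (rewrite H, in_succ; auto).
  apply in_succ in Hx as [Hx|Hx]; [|exact Hx].
  apply in_succ in Hy as [Hy|Hy]; [|auto].
  destruct (mem_asym Hx Hy).
Qed.

Lemma succ_neq_emp (x : V M) : succ x <> emp.
Proof.
  intro H. apply (@in_emp x). rewrite <- H. apply in_succ. auto.
Qed.

Fixpoint num (k : nat) : V M :=
  match k with O => emp | S j => succ (num j) end.

Lemma is_num_iff (k : nat) (x : V M) : is_num k x <-> x = num k.
Proof.
  revert x. induction k as [|k IH]; intro x; simpl.
  - apply is_empty_iff.
  - split.
    + intros [y [Hy Hx]]. apply IH in Hy as ->. apply is_succ_iff, Hx.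
    + intros ->. exists (num k). rewrite IH, is_succ_iff. auto.
Qed.

Lemma num_inj (j k : nat) : num j = num k -> j = k.
Proof.
  revert k. induction j as [|j IH]; intros [|k] H; simpl in H.
  - reflexivity.
  - symmetry in H. destruct (succ_neq_emp H).
  - destruct (succ_neq_emp H).
  - f_equal. apply IH, succ_inj, H.
Qed.

(** * Rank *)

(* An initial segment of the graph of the rank function; its domain is
   transitive. *)
Definition rank_approx (f : V M) : Prop :=
  forall x a, opair x a ∈ f ->
    (forall z, z ∈ x -> exists c, opair z c ∈ f) /\
    (forall b, b ∈ a <->
       exists z c, z ∈ x /\ opair z c ∈ f /\ (b ∈ c \/ b = c)).

Definition has_rank (x a : V M) : Prop :=
  exists f, rank_approx f /\ opair x a ∈ f.

Lemma definable_has_rank : definable (fun e => has_rank (e 0) (e 1)).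
Proof. unfold has_rank, rank_approx. dfn. Qed.

Lemma has_rank_unique (x : V M) :
  forall a a', has_rank x a -> has_rank x a' -> a = a'.
Proof.
  pose proof definable_has_rank.
  revert x. mem_induction. intros x IH a a' (f & Hf & Hx) (f' & Hf' & Hx').
  assert (K : forall f f' a a', rank_approx f -> rank_approx f' ->
    opair x a ∈ f -> opair x a' ∈ f' -> forall b, b ∈ a -> b ∈ a').
  { clear - IH. intros f f' a a' Hf Hf' Hx Hx' b Hb.
    apply (proj2 (Hf x a Hx)) in Hb as (z & c & Hz & Hc & Hb).
    destruct (proj1 (Hf' x a' Hx') z Hz) as [c' Hc'].
    apply (proj2 (Hf' x a' Hx')). exists z, c'. repeat split; auto.
    replace c' with c; auto.
    apply (IH z Hz); [exists f|exists f']; auto. }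
  apply (gbc_set_ext G). intro b.
  split; [apply (K f f' a a')|apply (K f' f a' a)]; assumption.
Qed.

Lemma has_rank_total (x : V M) : exists a, has_rank x a.
Proof.
  pose proof definable_has_rank.
  revert x. mem_induction. intros x IH.
  (* Assuming that [x] has no rank keeps [x] out of the domains of the approximations glued below,
     so the new pair for [x] cannot disturb them. *)
  apply NNPP. intro Hno. apply Hno.
  (* The least approximation defined at [z], so that replacement applies. *)
  set (least := fun z g => forall p, p ∈ g <->
    forall f, rank_approx f -> (exists a, opair z a ∈ f) -> p ∈ f).
  assert (Hleast : forall z, z ∈ x ->
    exists g, least z g /\ rank_approx g /\ exists c, opair z c ∈ g).
  { intros z Hz. destruct (IH z Hz) as (a & f & Hf & Hza).
    destruct (separation (P := fun p => forall f, rank_approx f ->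
      (exists a, opair z a ∈ f) -> p ∈ f) f) as [g Hg].
    { unfold rank_approx. dfn. }
    assert (Hg' : least z g).
    { intro p. rewrite Hg. split; [tauto|]. intro K. split; [|exact K].
      apply K; eauto. }
    (* Ranks are unique, so all approximations agree where they are defined; this keeps the domain
       of their intersection [g] transitive. *)
    assert (Hstep : forall y c, opair y c ∈ g -> forall z c', z ∈ y ->
      opair z c' ∈ f -> opair z c' ∈ g).
    { intros y c Hy u c' Hu Huc. apply Hg'. intros f' Hf' Hz'.
      pose proof (proj1 (Hg' _) Hy f' Hf' Hz') as Hyf'.
      destruct (proj1 (Hf' y c Hyf') u Hu) as [d Hd].
      replace c' with d; auto.
      apply (@has_rank_unique u); [exists f'|exists f]; auto. }
    exists g. split; [exact Hg'|]. split.
    - intros y c Hy.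
      assert (Hyf : opair y c ∈ f) by exact (proj1 (proj1 (Hg _) Hy)).
      split.
      + intros u Hu. destruct (proj1 (Hf y c Hyf) u Hu) as [d Hd].
        exists d. eapply Hstep; eauto.
      + intro b. rewrite (proj2 (Hf y c Hyf) b).
        split; intros (u & d & Hu & Hd & Hb); exists u, d;
          repeat split; auto.
        * eapply Hstep; eauto.
        * exact (proj1 (proj1 (Hg _) Hd)).
    - exists a. apply Hg'. intros f' Hf' [a' Ha'].
      replace a with a'; auto.
      apply (@has_rank_unique z); [exists f'|exists f]; auto. }
  destruct (replacement (F := least) x) as [B HB].
  { unfold least, rank_approx. dfn. }
  { intros z g g' Hg Hg'. apply (gbc_set_ext G). intro p.
    rewrite (Hg p), (Hg' p). tauto. }
  destruct (replacement (F := fun z s => exists c, has_rank z c /\ s = succ c) x)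
    as [D HD].
  { dfn. }
  { intros z s s' (c & Hc & ->) (c' & Hc' & ->).
    rewrite (has_rank_unique Hc Hc'). reflexivity. }
  assert (HU : forall z c, opair z c ∈ union B ->
    exists g, rank_approx g /\ (forall p, p ∈ g -> p ∈ union B) /\ opair z c ∈ g).
  { intros z c Hzc. apply in_union in Hzc as (g & Hp & Hg).
    pose proof Hg as Hg'. apply HB in Hg' as (y & Hy & Hl).
    destruct (Hleast y Hy) as (g' & Hl' & Hr & _).
    assert (g' = g) as ->.
    { apply (gbc_set_ext G). intro p. rewrite (Hl p), (Hl' p). tauto. }
    exists g. split; [exact Hr|]. split; [|exact Hp].
    intros q Hq. apply in_union. eauto. }
  assert (HUx : forall z, z ∈ x -> exists c, opair z c ∈ union B).
  { intros z Hz. destruct (Hleast z Hz) as (g & Hl & Hr & c & Hc).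
    exists c. apply in_union. exists g. split; [exact Hc|].
    apply HB. eauto. }
  assert (Hrk : forall z c, opair z c ∈ union B -> has_rank z c).
  { intros z c Hzc. destruct (HU z c Hzc) as (g & Hg & _ & Hp).
    exists g. auto. }
  exists (union D), (adjoin (union B) (opair x (union D))). split.
  2:{ apply in_adjoin. auto. }
  intros y a Hy. apply in_adjoin in Hy as [Hy|Hy].
  - destruct (HU y a Hy) as (g & Hg & Hsub & Hyg).
    destruct (Hg y a Hyg) as [H1 H2]. split.
    + intros z Hz. destruct (H1 z Hz) as [c Hc]. exists c.
      apply in_adjoin. auto.
    + intro b. rewrite H2. split.
      * intros (z & c & Hz & Hc & Hb). exists z, c.
        rewrite in_adjoin. auto.
      * intros (z & c & Hz & Hc & Hb). exists z, c.
        repeat split; auto.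
        destruct (H1 z Hz) as [d Hd].
        replace c with d; auto.
        assert (Hzd : has_rank z d) by (exists g; auto).
        apply in_adjoin in Hc as [Hc|Hc].
        -- apply (has_rank_unique Hzd), Hrk, Hc.
        -- apply opair_inj in Hc as [-> _]. destruct Hno. eauto.
  - apply opair_inj in Hy as [-> ->]. split.
    + intros z Hz. destruct (HUx z Hz) as [c Hc]. exists c.
      apply in_adjoin. auto.
    + intro b. rewrite in_union. split.
      * intros (s & Hb & Hs). apply HD in Hs as (z & Hz & c & Hc & ->).
        apply in_succ in Hb. exists z, c. repeat split; auto.
        apply in_adjoin. left. destruct (HUx z Hz) as [d Hd].
        rewrite (has_rank_unique Hc (Hrk z d Hd)). exact Hd.
      * intros (z & c & Hz & Hc & Hb). exists (succ c). rewrite in_succ.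
        split; [exact Hb|]. apply HD. exists z. split; [exact Hz|].
        exists c. split; [|reflexivity].
        apply in_adjoin in Hc as [Hc|Hc]; [auto|].
        apply opair_inj in Hc as [-> _]. destruct (mem_irrefl Hz).
Qed.

Definition rk (x : V M) : V M := the (has_rank_total x).

Lemma has_rank_iff (x a : V M) : has_rank x a <-> a = rk x.
Proof.
  pose proof (theP (has_rank_total x)) as H. split.
  - intro Ha. exact (has_rank_unique Ha H).
  - intros ->. exact H.
Qed.

Lemma dterm_rk (t : env -> V M) : dterm t -> dterm (fun e => rk (t e)).
Proof.
  apply dterm_subst1.
  apply definable_ext with (fun e => has_rank (e 1) (e 0)).
  - intro e. apply has_rank_iff.
  - pose proof definable_has_rank. dfn.
Qed.

Lemma in_rk (x a : V M) :
  a ∈ rk x <-> exists z, z ∈ x /\ (a ∈ rk z \/ a = rk z).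
Proof.
  destruct (theP (has_rank_total x)) as (f & Hf & Hx).
  fold (rk x) in Hx. destruct (Hf x (rk x) Hx) as [H1 H2]. rewrite H2. split.
  - intros (z & c & Hz & Hc & Ha). exists z. split; [exact Hz|].
    replace (rk z) with c; [exact Ha|].
    apply has_rank_iff. exists f. auto.
  - intros (z & Hz & Ha). destruct (H1 z Hz) as [c Hc].
    exists z, c. repeat split; auto.
    replace c with (rk z); [exact Ha|].
    symmetry. apply has_rank_iff. exists f. auto.
Qed.

Lemma rk_mem (x y : V M) : x ∈ y -> rk x ∈ rk y.
Proof. intro H. apply in_rk. eauto. Qed.

Ltac dfn_defined ::=
  match goal with
  | |- dterm (fun e => upair _ _) => apply dterm_upair
  | |- dterm (fun e => union _) => apply dterm_union
  | |- dterm (fun e => rk _) => apply dterm_rk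
  end.

Lemma rk_transitive (x : V M) : forall a b, a ∈ rk x -> b ∈ a -> b ∈ rk x.
Proof.
  revert x. mem_induction. intros x IH a b Ha Hb.
  apply in_rk in Ha as (z & Hz & Ha). apply in_rk. exists z.
  split; [exact Hz|]. left. destruct Ha as [Ha| ->]; eauto.
Qed.

Lemma in_rk_rk (x : V M) : forall a, a ∈ rk x -> exists z, a = rk z.
Proof.
  revert x. mem_induction. intros x IH a Ha.
  apply in_rk in Ha as (z & Hz & [Ha| ->]); eauto.
Qed.

(** Double membership induction: if neither rank is below the other, then each member of either set
    has rank below that of the other set, and the two ranks have the same elements. *)
Lemma rk_trichotomy (x : V M) :
  forall y, rk x ∈ rk y \/ rk x = rk y \/ rk y ∈ rk x.
Proof.
  revert x. mem_induction. intros x IHx.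
  mem_induction. intros y IHy.
  apply NNPP. intro H. apply H. right. left.
  assert (Hx : forall z, z ∈ x -> rk z ∈ rk y).
  { intros z Hz. pose proof (rk_mem Hz) as Hzx.
    destruct (IHx z Hz y) as [K|[K|K]]; [exact K| |]; destruct H; right; right.
    - rewrite <- K. exact Hzx.
    - exact (rk_transitive Hzx K). }
  assert (Hy : forall z, z ∈ y -> rk z ∈ rk x).
  { intros z Hz. pose proof (rk_mem Hz) as Hzy.
    destruct (IHy z Hz) as [K|[K|K]]; [| |exact K]; destruct H; left.
    - exact (rk_transitive Hzy K).
    - rewrite K. exact Hzy. }
  apply (gbc_set_ext G). intro a.
  split; intro Ha; apply in_rk in Ha as (z & Hz & [Ha| ->]); auto.
  - exact (rk_transitive (Hx z Hz) Ha).
  - exact (rk_transitive (Hy z Hz) Ha).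
Qed.

Lemma is_ord_rk (x : V M) : is_ord (rk x).
Proof.
  split.
  - intros a Ha b Hb. exact (rk_transitive Ha Hb).
  - intros a b Ha Hb. apply in_rk_rk in Ha as [y ->], Hb as [z ->].
    apply rk_trichotomy.
Qed.

(** * Natural numbers and finite sequences *)

Lemma is_ord_mem (a x : V M) : is_ord a -> x ∈ a -> is_ord x.
Proof.
  intros [Ht Hc] Hx. split.
  - intros y Hy z Hz.
    assert (Hya : y ∈ a) by exact (Ht x Hx y Hy).
    assert (Hza : z ∈ a) by exact (Ht y Hya z Hz).
    destruct (Hc z x Hza Hx) as [K|[->|K]].
    + exact K.
    + destruct (mem_asym Hy Hz).
    + destruct (mem_no_3cycle Hz Hy K).
  - intros y z Hy Hz. apply Hc; eapply Ht; eauto.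
Qed.

Lemma is_nat_emp : is_nat emp.
Proof.
  split; [split|].
  - intros x Hx. destruct (in_emp Hx).
  - intros x y Hx. destruct (in_emp Hx).
  - intros m [Hm| ->].
    + destruct (in_emp Hm).
    + left. exact in_emp.
Qed.

Lemma is_nat_succ (n : V M) : is_nat n -> is_nat (succ n).
Proof.
  intros [[Ht Hc] Hn]. split; [split|].
  - intros x Hx y Hy. apply in_succ. left.
    apply in_succ in Hx as [Hx| ->]; [exact (Ht x Hx y Hy)|exact Hy].
  - intros x y Hx Hy. apply in_succ in Hx, Hy.
    destruct Hx as [Hx| ->], Hy as [Hy| ->]; auto.
  - intros m [Hm| ->].
    + apply Hn. apply in_succ, Hm.
    + right. exists n. apply is_succ_iff. reflexivity.
Qed.

Lemma is_nat_mem (n m : V M) : is_nat n -> m ∈ n -> is_nat m.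
Proof.
  intros [Ho Hn] Hm. split; [exact (is_ord_mem Ho Hm)|].
  intros k [Hk| ->]; apply Hn; left; [|exact Hm].
  exact (proj1 Ho m Hm k Hk).
Qed.

Lemma is_nat_pred (n : V M) : is_nat (succ n) -> is_nat n.
Proof. intro H. apply (is_nat_mem H), in_succ. auto. Qed.

Lemma is_nat_cases (n : V M) :
  is_nat n -> n = emp \/ exists k, is_nat k /\ n = succ k.
Proof.
  intro Hn. destruct (proj2 Hn n (or_intror eq_refl)) as [H|[k Hk]].
  - left. apply is_empty_iff, H.
  - right. exists k. apply is_succ_iff in Hk as ->.
    split; [exact (is_nat_pred Hn)|reflexivity].
Qed.

(** The numbers of the model need not be standard, so induction along them comes from foundation and
    is available for definable [P] only. *)
Lemma nat_ind_internal (P : V M -> Prop) :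
  definable (fun e => P (e 0)) -> P emp ->
  (forall n, is_nat n -> P n -> P (succ n)) -> forall n, is_nat n -> P n.
Proof.
  intros HP H0 HS. mem_induction. intros n IH Hn.
  destruct (is_nat_cases Hn) as [->|(k & Hk & ->)]; [exact H0|].
  apply HS, IH; auto. apply in_succ. auto.
Qed.

Ltac nat_induction :=
  match goal with
  | |- forall n, is_nat n -> @?P n =>
      apply (nat_ind_internal (P := P)); [dfn | cbv beta | cbv beta]
  end.

(** * Parity *)

Definition alternates (e n : V M) : Prop :=
  (forall z, is_empty z -> z ∈ e) /\
  (forall k k', k ∈ n -> is_succ k' k -> (k' ∈ e <-> ~ k ∈ e)).

Lemma alternates_succ (e n : V M) :
  alternates e (succ n) -> alternates e n /\ (succ n ∈ e <-> ~ n ∈ e).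
Proof.
  intros [H0 HS]. split; [split|].
  - exact H0.
  - intros k k' Hk Hk'. apply HS; [apply in_succ; auto|exact Hk'].
  - apply HS; [apply in_succ; auto|apply is_succ_iff; reflexivity].
Qed.

(** All witnesses contain [emp] and alternate from there, so they agree at [n]. One witness can thus
    refute the existential statement [is_even n] as well as prove it. *)
Lemma alternates_unique (e e' n : V M) :
  is_nat n -> alternates e n -> alternates e' n -> (n ∈ e <-> n ∈ e').
Proof.
  revert n. nat_induction.
  - intros [H _] [H' _]. split; intros _; [apply H'|apply H]; exact in_emp.
  - intros n Hn IH H H'. apply alternates_succ in H as [H1 H2].
    apply alternates_succ in H' as [H1' H2']. specialize (IH H1 H1'). tauto.
Qed.

Lemma alternates_exists (n : V M) : is_nat n -> exists e, alternates e n.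
Proof.
  revert n. nat_induction.
  - exists (upair emp emp). split.
    + intros z Hz. apply is_empty_iff in Hz as ->. apply in_upair. auto.
    + intros k k' Hk. destruct (in_emp Hk).
  - intros n Hn [e [H0 HS]].
    (* The witness [e] is unconstrained above [n] and may contain [succ n] wrongly; membership of
       [succ n] is therefore reset and everything else is kept. *)
    destruct (separation (P := fun k => k = succ n -> ~ n ∈ e)
      (adjoin e (succ n))) as [e' He']; [dfn|].
    assert (K : forall k, k ∈ e' <->
      (k = succ n /\ ~ n ∈ e) \/ (k <> succ n /\ k ∈ e)).
    { intro k. rewrite He', in_adjoin. destruct (classic (k = succ n)); tauto. }
    assert (Hne : forall k, k ∈ succ n -> k <> succ n)
      by (intros k Hk ->; exact (mem_irrefl Hk)).
    exists e'. split.
    + intros z Hz. apply K. right. split; [|auto]. intros ->.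
      apply is_empty_iff in Hz. exact (succ_neq_emp Hz).
    + intros k k' Hk Hk'. apply is_succ_iff in Hk' as ->.
      pose proof (Hne k Hk) as Hkn. rewrite !K.
      apply in_succ in Hk as [Hk| ->]; [|tauto].
      specialize (HS k (succ k) Hk (proj2 (is_succ_iff _ _) eq_refl)).
      assert (succ k <> succ n)
        by (intro H; apply succ_inj in H as ->; exact (mem_irrefl Hk)).
      tauto.
Qed.

Lemma is_even_alternates (e n : V M) :
  is_nat n -> alternates e n -> (is_even n <-> n ∈ e).
Proof.
  intros Hn He. split.
  - intros (e' & H0 & HS & H). apply (alternates_unique (e := e') Hn); auto.
    split; assumption.
  - intro H. destruct He. exists e. auto.
Qed.

Lemma is_even_succ (n : V M) : is_nat n -> (is_even (succ n) <-> ~ is_even n).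
Proof.
  intro Hn. destruct (alternates_exists (is_nat_succ Hn)) as [e He].
  pose proof (alternates_succ He) as [He' H].
  rewrite (is_even_alternates (is_nat_succ Hn) He), (is_even_alternates Hn He').
  exact H.
Qed.

Lemma is_even_emp : is_even emp.
Proof.
  destruct (alternates_exists is_nat_emp) as [e He].
  apply (is_even_alternates is_nat_emp He). apply He. exact in_emp.
Qed.

(** * Finite sequences and their one-term extensions *)

Lemma is_fun_on_dom (s n m : V M) : is_fun_on s n -> is_fun_on s m -> n = m.
Proof.
  intros [_ H] [_ K]. apply (gbc_set_ext G). intro x. rewrite H, K. tauto.
Qed.

Lemma is_seq_length (s n m : V M) : is_seq s n -> is_seq s m -> n = m.
Proof. intros [_ H] [_ K]. exact (is_fun_on_dom H K). Qed.

(** Inside a common function a restriction is determined by its domain; this is how initial segments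
    of a play are identified. *)
Lemma fun_subset_eq (f s t n : V M) :
  is_fun f -> is_fun_on s n -> is_fun_on t n -> subset s f -> subset t f -> s = t.
Proof.
  assert (K : forall f s t n : V M, is_fun f -> is_fun_on s n -> is_fun_on t n ->
    subset s f -> subset t f -> subset s t).
  { clear f s t n. intros f s t n [_ Hf] [[Hs Hs'] Hsn] [[_ Ht] Htn] Hsf Htf p Hp.
    destruct (Hs p Hp) as (x & y & Hxy). apply is_opair_iff in Hxy as ->.
    assert (Hx : x ∈ n) by (apply Hsn; exists y; apply app_iff, Hp).
    apply Htn in Hx as [y' Hy']. apply app_iff in Hy'.
    replace y with y'; [exact Hy'|].
    apply (Hf x); apply app_iff; auto. }
  intros Hf Hs Ht Hsf Htf. apply (gbc_set_ext G). intro p. split.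
  - exact (K f s t n Hf Hs Ht Hsf Htf p).
  - exact (K f t s n Hf Ht Hs Htf Hsf p).
Qed.

Lemma is_seq_emp : is_seq emp emp.
Proof.
  split; [exact is_nat_emp|]. split; [split|].
  - intros p Hp. destruct (in_emp Hp).
  - intros x y z H. apply app_iff in H. destruct (in_emp H).
  - intro x. split; [intro H; destruct (in_emp H)|].
    intros [y H]. apply app_iff in H. destruct (in_emp H).
Qed.

Lemma is_seq_emp_iff (s n : V M) : is_seq s n -> (s = emp <-> n = emp).
Proof.
  intro H. split.
  - intros ->. exact (is_seq_length H is_seq_emp).
  - intros ->. destruct H as [_ [[Hp _] Hd]]. apply is_empty_iff.
    intros p K. destruct (Hp p K) as (x & y & Hxy).
    apply is_opair_iff in Hxy as ->.
    apply (@in_emp x), Hd. exists y. apply app_iff, K.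
Qed.

Definition snoc s n z := adjoin s (opair n z).

Lemma app_snoc (s n z x y : V M) :
  app (snoc s n z) x y <-> app s x y \/ x = n /\ y = z.
Proof.
  unfold snoc. rewrite !app_iff, in_adjoin. split; intros [H|H]; auto.
  - right. apply opair_inj, H.
  - destruct H as [-> ->]. auto.
Qed.

Lemma subset_snoc (s n z : V M) : subset s (snoc s n z).
Proof. intros p Hp. apply in_adjoin. auto. Qed.

Lemma app_dom (s n x y : V M) : is_seq s n -> app s x y -> x ∈ n.
Proof. intros [_ [_ H]] K. apply H. eauto. Qed.

Lemma app_fun (s n x y y' : V M) :
  is_seq s n -> app s x y -> app s x y' -> y = y'.
Proof. intros [_ [[_ H] _]]. apply H. Qed.

Lemma is_seq_snoc (s n z : V M) : is_seq s n -> is_seq (snoc s n z) (succ n).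
Proof.
  intro H. split; [apply is_nat_succ, H|]. split; [split|].
  - intros p Hp. apply in_adjoin in Hp as [Hp| ->].
    + apply H, Hp.
    + exists n, z. apply is_opair_iff. reflexivity.
  - intros x y y' Hy Hy'. rewrite app_snoc in Hy, Hy'.
    destruct Hy as [Hy|[-> ->]], Hy' as [Hy'|[E ->]]; auto.
    + exact (app_fun H Hy Hy').
    + subst x. destruct (mem_irrefl (app_dom H Hy)).
    + destruct (mem_irrefl (app_dom H Hy')).
  - intro x. rewrite in_succ. split.
    + intros [Hx| ->].
      * apply (proj2 (proj2 H)) in Hx as [y Hy]. exists y.
        apply app_snoc. auto.
      * exists z. apply app_snoc. auto.
    + intros [y Hy]. apply app_snoc in Hy as [Hy|[-> _]]; auto.
      left. exact (app_dom H Hy).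
Qed.

Lemma extends1_snoc (s n z : V M) : is_seq s n -> extends1 s (snoc s n z).
Proof.
  intro H. exists n, (succ n). split; [exact H|].
  split; [exact (is_seq_snoc z H)|]. split; [apply is_succ_iff; reflexivity|].
  apply subset_snoc.
Qed.

Lemma extends1_inv (s s' n : V M) :
  is_seq s n -> extends1 s s' -> exists z, s' = snoc s n z.
Proof.
  intros Hs (m & m' & Hm & Hm' & Hmm & Hsub).
  apply is_succ_iff in Hmm as ->.
  rewrite (is_seq_length Hm Hs) in *. clear m Hm.
  assert (Hn : n ∈ succ n) by (apply in_succ; auto).
  apply (proj2 (proj2 Hm')) in Hn as [z Hz]. exists z. symmetry.
  apply (fun_subset_eq (f := s') (n := succ n)).
  - apply Hm'.
  - apply (is_seq_snoc z Hs).
  - apply Hm'.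
  - intros p Hp. apply in_adjoin in Hp as [Hp| ->]; auto.
    apply app_iff, Hz.
  - intros p Hp. exact Hp.
Qed.

Lemma subset_snoc_inv (s n z t m : V M) :
  is_seq s n -> is_seq t m -> subset t (snoc s n z) ->
  subset t s \/ t = snoc s n z.
Proof.
  intros Hs Ht Hsub. destruct (classic (n ∈ m)) as [Hn|Hn].
  - right. apply (fun_subset_eq (f := snoc s n z) (n := succ n)); auto.
    + apply (is_seq_snoc z Hs).
    + replace (succ n) with m; [apply Ht|].
      apply (gbc_set_ext G). intro x. rewrite in_succ. split.
      * intro Hx. apply (proj2 (proj2 Ht)) in Hx as [y Hy].
        apply app_iff, Hsub, app_iff, app_snoc in Hy as [Hy|[-> _]]; auto.
        left. exact (app_dom Hs Hy).
      * intros [Hx| ->]; [|exact Hn].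
        exact (proj1 (proj1 (proj1 Ht)) n Hn x Hx).
    + apply (is_seq_snoc z Hs).
    + intros p Hp. exact Hp.
  - left. intros p Hp.
    destruct (proj1 (proj1 (proj2 Ht)) p Hp) as (x & y & Hxy).
    apply is_opair_iff in Hxy as ->.
    pose proof (Hsub _ Hp) as K. apply app_iff, app_snoc in K as [K|[-> ->]].
    + apply app_iff, K.
    + destruct Hn. apply (app_dom Ht (y := z)). apply app_iff, Hp.
Qed.

Lemma restriction (f n : V M) :
  is_fun f -> is_nat n -> (forall i, i ∈ n -> exists y, app f i y) ->
  exists s, is_seq s n /\ subset s f /\
    forall i y, i ∈ n -> app f i y -> app s i y.
Proof.
  intros [Hp Hf] Hn Hd.
  destruct (separation (P := fun p => exists i y, p = opair i y /\ i ∈ n) f)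
    as [s Hs]; [dfn|].
  assert (K : forall i y, app s i y <-> app f i y /\ i ∈ n).
  { intros i y. rewrite !app_iff, Hs. split.
    - intros (H & i' & y' & E & Hi). apply opair_inj in E as [-> ->]. auto.
    - intros [H Hi]. split; [exact H|]. exists i, y. auto. }
  exists s. split; [|split].
  - split; [exact Hn|]. split; [split|].
    + intros p Hps. apply Hp, Hs, Hps.
    + intros i y y' Hy Hy'. apply K in Hy, Hy'.
      exact (Hf i y y' (proj1 Hy) (proj1 Hy')).
    + intro i. split.
      * intro Hi. destruct (Hd i Hi) as [y Hy]. exists y. apply K. auto.
      * intros [y Hy]. apply K in Hy. apply Hy.
  - intros p Hps. apply Hs, Hps.
  - intros i y Hi Hy. apply K. auto.
Qed.

(** * The clopen game unfolding a well-founded graph *)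

Definition opponent (p : player) : player :=
  match p with I => II | II => I end.

Lemma to_move_snoc (p : player) (s n z : V M) :
  is_seq s n -> to_move p s -> to_move (opponent p) (snoc s n z).
Proof.
  intros Hs (m & Hm & Hp). rewrite (is_seq_length Hm Hs) in Hp. clear m Hm.
  exists (succ n). split; [exact (is_seq_snoc z Hs)|].
  pose proof (is_even_succ (proj1 Hs)).
  destruct p; simpl; tauto.
Qed.

Lemma to_move_exclusive (s : V M) : to_move I s -> to_move II s -> False.
Proof.
  intros (n & Hn & H) (m & Hm & K). rewrite (is_seq_length Hm Hn) in K.
  contradiction.
Qed.

Lemma to_move_opponent (p : player) (s : V M) :
  to_move p s -> ~ to_move (opponent p) s.
Proof.
  intros H K. destruct p; eapply to_move_exclusive; eauto.
Qed.

Lemma opponent_involutive (q : player) : opponent (opponent q) = q.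
Proof. destruct q; reflexivity. Qed.

Lemma to_move_emp : to_move I emp.
Proof.
  exists emp. split; [exact is_seq_emp|exact is_even_emp].
Qed.

Section GraphGame.

(* [MW y]: a player who has to move at the dead end [y] wins. *)
Context (Init MW : V M -> Prop) (Mv : V M -> V M -> Prop) (lab : V M -> V M).
Context (Init_def : definable (fun e => Init (e 0))).
Context (MW_def : definable (fun e => MW (e 0))).
Context (Mv_def : definable (fun e => Mv (e 0) (e 1))).
Context (lab_def : dterm (fun e => lab (e 0))).
Context (lab_ord : forall y, is_ord (lab y)).
Context (lab_Mv : forall y z, Mv y z -> lab z ∈ lab y).

(** * Paths in the graph as nodes of a game tree *)

Definition is_path (s : V M) : Prop :=
  exists n, is_seq s n /\ forall i y, app s i y ->
    (is_empty i -> Init y) /\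
    (forall j x, is_succ i j -> app s j x -> Mv x y).

Definition ends_at (s n y : V M) : Prop :=
  is_path s /\ is_seq s (succ n) /\ app s n y.

Lemma is_path_emp : is_path emp.
Proof.
  exists emp. split; [exact is_seq_emp|]. intros i y H.
  apply app_iff in H. destruct (in_emp H).
Qed.

Lemma ends_at_first (z : V M) : Init z -> ends_at (snoc emp emp z) emp z.
Proof.
  intro Hz. pose proof (is_seq_snoc z is_seq_emp) as Hs.
  split; [|split; [exact Hs|apply app_snoc; auto]].
  exists (succ emp). split; [exact Hs|].
  intros i y Hy. apply app_snoc in Hy as [Hy|[-> ->]].
  - apply app_iff in Hy. destruct (in_emp Hy).
  - split; [auto|]. intros j x Hj _. apply is_succ_iff in Hj.
    symmetry in Hj. destruct (succ_neq_emp Hj).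
Qed.

Lemma ends_at_snoc (s n y z : V M) :
  ends_at s n y -> Mv y z -> ends_at (snoc s (succ n) z) (succ n) z.
Proof.
  intros ([m [_ Hp]] & Hs & Hy) Hz. pose proof (is_seq_snoc z Hs) as Hs'.
  split; [|split; [exact Hs'|apply app_snoc; auto]].
  exists (succ (succ n)). split; [exact Hs'|].
  intros i v Hv. apply app_snoc in Hv as [Hv|[-> ->]].
  - destruct (Hp i v Hv) as [H1 H2]. split; [exact H1|].
    intros j x Hj Hx. apply app_snoc in Hx as [Hx|[-> ->]]; [eauto|].
    apply is_succ_iff in Hj as ->. apply (app_dom Hs) in Hv.
    destruct (@mem_asym (succ n) (succ (succ n))); [|exact Hv].
    apply in_succ. auto.
  - split.
    + intro K. apply is_empty_iff in K. destruct (succ_neq_emp K).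
    + intros j x Hj Hx. apply is_succ_iff in Hj. apply succ_inj in Hj as <-.
      apply app_snoc in Hx as [Hx|[E _]].
      * rewrite (app_fun Hs Hx Hy). exact Hz.
      * destruct (@mem_irrefl n). rewrite E at 2. apply in_succ. auto.
Qed.

Context (T : C M) (HT : forall s, s ∈c T <-> is_path s).

Lemma is_child_first (z : V M) : Init z -> is_child T emp (snoc emp emp z).
Proof.
  intro Hz. split; [|split].
  - apply HT, is_path_emp.
  - apply HT, ends_at_first, Hz.
  - apply extends1_snoc, is_seq_emp.
Qed.

Lemma is_child_snoc (s n y z : V M) :
  ends_at s n y -> Mv y z -> is_child T s (snoc s (succ n) z).
Proof.
  intros Hs Hz. split; [|split].
  - apply HT, Hs.
  - apply HT, (ends_at_snoc Hs Hz).
  - apply extends1_snoc, Hs.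
Qed.

Lemma is_child_first_inv (s : V M) :
  is_child T emp s -> exists z, Init z /\ s = snoc emp emp z.
Proof.
  intros (_ & Hs & Hext). apply (extends1_inv is_seq_emp) in Hext as [z ->].
  exists z. split; [|reflexivity]. apply HT in Hs as (n & _ & Hp).
  apply (Hp emp z); [apply app_snoc; auto|exact in_emp].
Qed.

Lemma is_child_snoc_inv (s s' n y : V M) :
  ends_at s n y -> is_child T s s' ->
  exists z, Mv y z /\ s' = snoc s (succ n) z.
Proof.
  intros (_ & Hs & Hy) (_ & Hs' & Hext).
  apply (extends1_inv Hs) in Hext as [z ->].
  exists z. split; [|reflexivity]. apply HT in Hs' as (m & _ & Hp).
  apply (Hp (succ n) z) with (j := n).
  - apply app_snoc. auto.
  - apply is_succ_iff. reflexivity.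
  - apply app_snoc. auto.
Qed.

Lemma ends_at_unique (s n n' y y' : V M) :
  ends_at s n y -> ends_at s n' y' -> n = n' /\ y = y'.
Proof.
  intros (_ & Hs & Hy) (_ & Hs' & Hy').
  assert (n = n') as <- by exact (succ_inj (is_seq_length Hs Hs')).
  split; [reflexivity|exact (app_fun Hs Hy Hy')].
Qed.

Lemma path_cases (s : V M) :
  is_path s -> s = emp \/ exists n y, ends_at s n y.
Proof.
  intros Hs. pose proof Hs as (m & Hm & _).
  destruct (is_nat_cases (proj1 Hm)) as [->|(n & Hn & ->)].
  - left. apply (is_seq_emp_iff Hm). reflexivity.
  - right. assert (H : n ∈ succ n) by (apply in_succ; auto).
    apply (proj2 (proj2 Hm)) in H as [y Hy]. exists n, y.
    split; [exact Hs|]. split; assumption.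
Qed.

Lemma is_terminal_iff (s n y : V M) :
  ends_at s n y -> (is_terminal T s <-> ~ exists z, Mv y z).
Proof.
  intro Hs. split.
  - intros [_ H] [z Hz]. apply H. exists (snoc s (succ n) z).
    exact (is_child_snoc Hs Hz).
  - intro H. split; [apply HT, Hs|]. intros [s' Hs'].
    apply (is_child_snoc_inv Hs) in Hs' as (z & Hz & _). eauto.
Qed.

(** Foundation gives a minimal label along an infinite branch, and the next state on the branch has
    a smaller one. *)
Lemma well_founded_paths : well_founded_tree T.
Proof.
  split; [split; [|split]|].
  - intros s Hs. apply HT in Hs as (n & Hn & _). eauto.
  - exists emp. split; [exact in_emp|]. apply HT, is_path_emp.
  - intros s n t Ht Hs Hsub. apply HT in Ht as (m & _ & Hp).
    assert (K : forall i y, app s i y -> app t i y).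
    { intros i y H. apply app_iff, Hsub, app_iff, H. }
    apply HT. exists n. split; [exact Hs|]. intros i y Hy.
    destruct (Hp i y (K i y Hy)) as [H1 H2]. split; eauto.
  - intros (f & Hf & Hd & Hb).
    destruct (foundation
      (P := fun a => exists n y, is_nat n /\ app f n y /\ a = lab y))
      as (a & (n & y & Hn & Hy & ->) & Hmin).
    + dfn.
    + destruct (proj1 (Hd emp) is_nat_emp) as [y Hy].
      exists (lab y), emp, y. split; [exact is_nat_emp|auto].
    + destruct (proj1 (Hd (succ n)) (is_nat_succ Hn)) as [z Hz].
      (* The tree sees finite sequences only; this length is the least for which both indices [n]
         and [succ n] lie in the initial segment. *)
      destruct (restriction (f := f) (n := succ (succ n)))
        as (s & Hs & Hsub & Hsf).
      * exact Hf.
      * do 2 apply is_nat_succ. exact Hn.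
      * intros i Hi. apply Hd. eapply is_nat_mem; [|exact Hi].
        do 2 apply is_nat_succ. exact Hn.
      * apply (Hb s _ Hs), HT in Hsub as (m & _ & Hp).
        apply (Hmin (lab z)).
        -- apply lab_Mv. apply (Hp (succ n) z) with (j := n).
           ++ apply Hsf; [apply in_succ; auto|exact Hz].
           ++ apply is_succ_iff. reflexivity.
           ++ apply Hsf; [rewrite !in_succ; auto|exact Hy].
        -- exists (succ n), z. split; [exact (is_nat_succ Hn)|auto].
Qed.

(** A nonempty path is labelled by [lab] of its last state. The root has no last state and its
    children may have unbounded labels, which is what the implicit label Ord allows. *)
Lemma rank_paths : rank_at_most_Ord_plus_1 T.
Proof.
  destruct (class_of (P := fun p => exists s n y,
    ends_at s n y /\ p = opair s (lab y))) as [R HR]; [dfn|].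
  assert (K : forall s n y b, ends_at s n y -> (cpair R s b <-> b = lab y)).
  { intros s n y b Hs. rewrite cpair_iff, HR. split.
    - intros (s' & n' & y' & Hs' & E). apply opair_inj in E as [<- ->].
      destruct (ends_at_unique Hs Hs') as [_ <-]. reflexivity.
    - intros ->. eauto. }
  exists R. split.
  - intros s Hs Hne. apply HT, path_cases in Hs as [->|(n & y & Hs)].
    + destruct Hne. exact in_emp.
    + exists (lab y). split; [apply lab_ord|]. intro b. exact (K s n y b Hs).
  - intros s s' a a' Hch Hne Ha Ha'.
    pose proof (proj1 (HT s) (proj1 Hch)) as Hs.
    apply path_cases in Hs as [->|(n & y & Hs)].
    + destruct Hne. exact in_emp.
    + destruct (is_child_snoc_inv Hs Hch) as (z & Hz & ->).
      apply (K _ _ _ _ Hs) in Ha as ->.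
      apply (K _ _ _ _ (ends_at_snoc Hs Hz)) in Ha' as ->.
      exact (lab_Mv Hz).
Qed.

(** * Plays that follow a winning strategy *)

Context (W : C M).
Context (HW : forall t, t ∈c W <-> exists n y, ends_at t n y /\
  ((to_move I t /\ MW y) \/ (to_move II t /\ ~ MW y))).
Context (p : player) (St : C M) (HSt : is_winning T W p St).

Lemma conforms_emp : conforms T p St emp.
Proof.
  intros s s' (_ & _ & n & n' & _ & Hs' & Hn & _) Hsub _.
  apply is_succ_iff in Hn as ->.
  assert (Hn : n ∈ succ n) by (apply in_succ; auto).
  apply (proj2 (proj2 Hs')) in Hn as [y Hy].
  apply app_iff, Hsub in Hy. destruct (in_emp Hy).
Qed.

Lemma conforms_snoc (s n z : V M) :
  is_seq s n -> conforms T p St s ->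
  (to_move p s -> cpair St s (snoc s n z)) -> conforms T p St (snoc s n z).
Proof.
  intros Hs Hc Hz t t' Ht Hsub Hp.
  pose proof Ht as (_ & _ & m & m' & Hm & Hm' & Hmm & Htt).
  apply is_succ_iff in Hmm as ->.
  destruct (subset_snoc_inv Hs Hm' Hsub) as [K|K].
  - exact (Hc t t' Ht K Hp).
  - subst t'.
    assert (m = n) as ->
      by exact (succ_inj (is_seq_length Hm' (is_seq_snoc z Hs))).
    assert (t = s) as ->; [|auto].
    apply (fun_subset_eq (f := snoc s n z) (n := n)).
    + apply Hm'.
    + apply Hm.
    + apply Hs.
    + exact Htt.
    + apply subset_snoc.
Qed.

(** Forgets the history of the play. The only quantifiers are over sets, with [T] and [St] as class
    parameters, so comprehension applies. *)
Definition reachable (q : player) (y : V M) : Prop :=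
  exists s n, ends_at s n y /\ conforms T p St s /\ to_move q s.

Lemma definable_reachable (q : player) :
  definable (fun e => reachable q (e 0)).
Proof. clear HSt. unfold reachable, conforms. destruct p, q; dfn. Qed.

Lemma reachable_opponent_move (y z : V M) :
  reachable (opponent p) y -> Mv y z -> reachable p z.
Proof.
  intros (s & n & Hs & Hc & Hq) Hz. exists (snoc s (succ n) z), (succ n).
  split; [exact (ends_at_snoc Hs Hz)|].
  pose proof (proj1 (proj2 Hs)) as Hseq. split.
  - apply (conforms_snoc Hseq Hc). intro Hp.
    destruct (to_move_opponent Hp Hq).
  - rewrite <- (opponent_involutive p). exact (to_move_snoc z Hseq Hq).
Qed.

Lemma reachable_own_move (y : V M) :
  reachable p y -> (exists z, Mv y z) ->
  exists z, Mv y z /\ reachable (opponent p) z.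
Proof.
  intros (s & n & Hs & Hc & Hp) Hex.
  pose proof (proj1 (proj2 Hs)) as Hseq.
  destruct (proj1 HSt s) as (s' & Hch & Hs').
  - apply HT, Hs.
  - intro K. apply (is_terminal_iff Hs) in K. contradiction.
  - exact Hp.
  - destruct (is_child_snoc_inv Hs Hch) as (z & Hz & ->).
    exists z. split; [exact Hz|]. exists (snoc s (succ n) z), (succ n).
    split; [exact (ends_at_snoc Hs Hz)|]. split.
    + apply (conforms_snoc Hseq Hc). intros _. apply Hs'. reflexivity.
    + exact (to_move_snoc z Hseq Hp).
Qed.

(** The owner [p] wins every conforming play, whereas [MW] speaks about the mover; so [MW] holds
    exactly when the mover is the owner. *)
Lemma reachable_dead_end (q : player) (y : V M) :
  reachable q y -> ~ (exists z, Mv y z) -> (q = p <-> MW y).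
Proof.
  intros (s & n & Hs & Hc & Hq) Hex.
  pose proof (proj2 HSt s (proj2 (is_terminal_iff Hs) Hex) Hc) as Hwin.
  assert (HWs : s ∈c W <-> ((to_move I s /\ MW y) \/ (to_move II s /\ ~ MW y))).
  { rewrite HW. split.
    - intros (n' & y' & Hs' & H). destruct (ends_at_unique Hs Hs') as [_ ->].
      exact H.
    - intro H. exists n, y. auto. }
  pose proof (@to_move_exclusive s) as Hexcl.
  destruct p, q; simpl in Hwin; rewrite HWs in Hwin;
    (split; [intro E; try discriminate|intro E; try reflexivity]); tauto.
Qed.

(** The choice of an initial state is the first move of I: made by the strategy if I owns it,
    arbitrary if II does. Either way II moves next. *)
Lemma reachable_first :
  match p with
  | I => (exists z, Init z) -> exists z, Init z /\ reachable II z
  | II => forall z, Init z -> reachable II z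
  end.
Proof.
  assert (K : forall z, Init z ->
    (to_move p emp -> cpair St emp (snoc emp emp z)) -> reachable II z).
  { intros z Hz H. exists (snoc emp emp z), emp.
    split; [exact (ends_at_first Hz)|]. split.
    - exact (conforms_snoc is_seq_emp conforms_emp H).
    - exact (to_move_snoc z is_seq_emp to_move_emp). }
  destruct p.
  - intros [z0 Hz0]. destruct (proj1 HSt emp) as (s' & Hch & Hs').
    + apply HT, is_path_emp.
    + intros [_ H]. apply H. exists (snoc emp emp z0).
      exact (is_child_first Hz0).
    + exact to_move_emp.
    + destruct (is_child_first_inv Hch) as (z & Hz & ->).
      exists z. split; [exact Hz|]. apply (K z Hz). intros _.
      apply Hs'. reflexivity.
  - intros z Hz. apply (K z Hz). intro H.
    destruct (to_move_exclusive to_move_emp H).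
Qed.

(* At a state [y] where both were reachable the strategy could be played
   against itself, until a dead end won by both sides. *)
Lemma reachable_exclusive (y : V M) :
  reachable p y -> reachable (opponent p) y -> False.
Proof.
  intros Hy Hy'.
  pose proof (definable_reachable p) as D.
  pose proof (definable_reachable (opponent p)) as D'.
  destruct (foundation (P := fun a => exists y,
    reachable p y /\ reachable (opponent p) y /\ a = lab y))
    as (a & (z & Hz & Hz' & ->) & Hmin).
  - dfn.
  - eauto.
  - destruct (classic (exists u, Mv z u)) as [Hex|Hex].
    + destruct (reachable_own_move Hz Hex) as (u & Hu & Hu').
      pose proof (reachable_opponent_move Hz' Hu).
      apply (Hmin (lab u) (lab_Mv Hu)). eauto.
    + pose proof (reachable_dead_end Hz Hex) as H.
      pose proof (reachable_dead_end Hz' Hex) as H'.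
      destruct p; simpl in H'; intuition congruence.
Qed.

End GraphGame.

(* [P] and [Q] describe the states that a winning strategy reaches with its
   owner, respectively the opponent, to move. *)
Lemma graph_game (Init MW : V M -> Prop) (Mv : V M -> V M -> Prop)
    (lab : V M -> V M) :
  clopen_determinacy_rank_Ord_plus_1 M ->
  definable (fun e => Init (e 0)) -> definable (fun e => MW (e 0)) ->
  definable (fun e => Mv (e 0) (e 1)) -> dterm (fun e => lab (e 0)) ->
  (forall y, is_ord (lab y)) -> (forall y z, Mv y z -> lab z ∈ lab y) ->
  exists (p : player) (P Q : V M -> Prop),
    definable (fun e => Q (e 0)) /\
    (forall y, P y -> Q y -> False) /\
    (forall y z, Q y -> Mv y z -> P z) /\
    (forall y, P y -> (exists z, Mv y z) -> exists z, Mv y z /\ Q z) /\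
    (forall y, P y -> ~ (exists z, Mv y z) -> MW y) /\
    (forall y, Q y -> ~ (exists z, Mv y z) -> ~ MW y) /\
    match p with
    | I => (exists z, Init z) -> exists z, Init z /\ Q z
    | II => forall z, Init z -> P z
    end.
Proof.
  intros Hdet HI HMW HMv Hlab Hord Hdec.
  destruct (class_of (P := is_path Init Mv)) as [T HT]; [dfn|].
  destruct (class_of (P := fun t => exists n y, ends_at Init Mv t n y /\
    ((to_move I t /\ MW y) \/ (to_move II t /\ ~ MW y)))) as [W HW]; [dfn|].
  destruct (Hdet T W) as (p & St & HSt).
  - exact (well_founded_paths Hlab Hdec HT).
  - exact (rank_paths HI HMv Hlab Hord Hdec HT).
  - exists p, (reachable Init Mv T p St p),
      (reachable Init Mv T p St (opponent p)).
    split; [|split; [|split; [|split; [|split; [|split]]]]].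
    + exact (definable_reachable HI HMv T p St (opponent p)).
    + exact (reachable_exclusive HI HMv Hlab Hdec HT HW HSt).
    + exact (@reachable_opponent_move Init Mv T p St).
    + exact (reachable_own_move HT HSt).
    + intros y Hy Hex. apply (reachable_dead_end HT HW HSt Hy Hex).
      reflexivity.
    + intros y Hy Hex K. apply (reachable_dead_end HT HW HSt Hy Hex) in K.
      destruct p; discriminate.
    + pose proof (reachable_first HT HSt). destruct p; assumption.
Qed.

(** * The truth-telling game *)

Lemma first_exists (y : V M) : exists a,
  (exists b, y = opair a b) \/ (a = emp /\ ~ exists c d, y = opair c d).
Proof.
  destruct (classic (exists c d, y = opair c d)) as [(c & d & H)|H]; eauto.
Qed.

(** Labels are required of all sets; fixing the value [emp] off the pairs keeps the graph
    definable. *)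
Definition first (y : V M) : V M := the (first_exists y).

Lemma first_opair (a b : V M) : first (opair a b) = a.
Proof.
  destruct (theP (first_exists (opair a b))) as [[c H]|[_ H]].
  - symmetry. apply (opair_inj H).
  - destruct H. eauto.
Qed.

Lemma dterm_first (t : env -> V M) : dterm t -> dterm (fun e => first (t e)).
Proof.
  apply dterm_subst1. apply definable_ext with
    (fun e => (exists b, e 1 = opair (e 0) b) \/
              (e 0 = emp /\ ~ exists c d, e 1 = opair c d)).
  - intro e. generalize (e 0) (e 1). clear e. intros a y. split.
    + intros [[b ->]|[-> H]]; [symmetry; apply first_opair|].
      destruct (theP (first_exists y)) as [[c K]|[K _]]; [|auto].
      destruct H. eauto.
    + intros ->. exact (theP (first_exists y)).
  - dfn.
Qed.

(** A standard numeral is a constant of the model, which avoids unfolding a recursion on [k]. *)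
Lemma definable_is_num (k : nat) (t : env -> V M) :
  dterm t -> definable (fun e => is_num k (t e)).
Proof.
  intro Ht. apply definable_ext with (fun e => t e = num k).
  - intro e. symmetry. apply is_num_iff.
  - apply definable_eq; [exact Ht|apply dterm_const].
Qed.

Ltac dfn_defined ::=
  match goal with
  | |- dterm (fun e => upair _ _) => apply dterm_upair
  | |- dterm (fun e => union _) => apply dterm_union
  | |- dterm (fun e => rk _) => apply dterm_rk
  | |- dterm (fun e => first _) => apply dterm_first
  | |- definable (fun e => is_num _ _) => apply definable_is_num
  end.

(** * Codes of formulas and the ranks of their components *)

Lemma tagged_iff (k : nat) (phi c : V M) :
  tagged k phi c <-> phi = opair (num k) c.
Proof.
  split.
  - intros (t & Ht & Hphi). apply is_num_iff in Ht as ->.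
    apply is_opair_iff, Hphi.
  - intros ->. exists (num k). rewrite is_num_iff, is_opair_iff. auto.
Qed.

Lemma tagged2_iff (k : nat) (phi a b : V M) :
  tagged2 k phi a b <-> phi = opair (num k) (opair a b).
Proof.
  split.
  - intros (c & Hc & Hphi). apply is_opair_iff in Hc as ->.
    apply tagged_iff, Hphi.
  - intros ->. exists (opair a b). rewrite is_opair_iff, tagged_iff. auto.
Qed.

Ltac tag_clash :=
  match goal with
  | H : opair (num _) _ = opair (num _) _ |- _ =>
      apply opair_inj, proj1, num_inj in H; discriminate H
  end.

(** The singleton of [x] has rank one more than [x], hence at most [rk y], which is below [rk z].
    Two membership steps leave room for one wrapping. *)
Lemma rk_sing (x y z : V M) : x ∈ y -> y ∈ z -> rk (upair x x) ∈ rk z.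
Proof.
  intros Hx Hy. apply rk_mem in Hx, Hy.
  pose proof (rk_transitive Hy Hx) as Hz.
  assert (K : ~ rk z ∈ rk x) by exact (mem_asym Hz).
  assert (L : rk z <> rk x) by (intro E; rewrite E in Hz; exact (mem_irrefl Hz)).
  assert (Hsing : forall a, a ∈ rk (upair x x) -> a ∈ rk x \/ a = rk x).
  { intros a Ha. apply in_rk in Ha as (w & Hw & Ha).
    apply in_upair in Hw as [->| ->]; exact Ha. }
  destruct (rk_trichotomy (upair x x) z) as [H|[H|H]]; [exact H| |].
  - rewrite <- H in Hy. apply Hsing in Hy as [Hy|Hy].
    + destruct (mem_asym Hx Hy).
    + rewrite Hy in Hx. destruct (mem_irrefl Hx).
  - apply Hsing in H. tauto.
Qed.

(** In a Kuratowski pair the second component lies two membership steps down. *)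
Lemma rk_opair_r (a b : V M) :
  rk b ∈ rk (opair a b) /\ rk (upair b b) ∈ rk (opair a b).
Proof.
  assert (H : b ∈ upair a b) by (apply in_upair; auto).
  assert (K : upair a b ∈ opair a b) by (apply in_upair; auto).
  split.
  - exact (rk_transitive (rk_mem K) (rk_mem H)).
  - exact (rk_sing H K).
Qed.

(* In the state [state k phi a] with [k = 0] ([k = 1]) the player to move
   claims that [phi] is false (true) under [a]; with [k = 2] he has to choose
   between these claims for his opponent.  The wrapping by singletons makes the
   rank of the first component decrease along moves. *)
Fixpoint wrap (k : nat) (phi : V M) : V M :=
  match k with O => phi | S j => upair (wrap j phi) (wrap j phi) end.

Definition state (k : nat) (phi a : V M) : V M :=
  opair (wrap k phi) (opair (num k) a).

Lemma state_inj (j k : nat) (phi psi a b : V M) :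
  state j phi a = state k psi b -> j = k /\ phi = psi /\ a = b.
Proof.
  intro H. apply opair_inj in H as [H K]. apply opair_inj in K as [K ->].
  apply num_inj in K as ->. split; [reflexivity|]. split; [|reflexivity].
  induction k as [|k IH]; [exact H|]. apply IH.
  simpl in H. apply upair_inj in H. tauto.
Qed.

Definition valid (phi a : V M) : Prop :=
  exists d, is_formula phi d /\ is_fun_on a d.

Definition opening (z : V M) : Prop :=
  exists phi a, valid phi a /\ z = state 2 phi a.

(** The mover is the falsifier. Under a negation the roles swap, so the opponent moves at once as
    the new falsifier. Conjunctions and quantifiers keep the falsifier; as turns alternate, the
    opponent has to pass in between, which is the purpose of [state 1]. *)
Definition descent (phi a z : V M) : Prop :=
  (exists psi, is_neg_fml phi psi /\ z = state 0 psi a) \/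
  (exists Phi psi, is_conj_fml phi Phi /\ psi ∈ Phi /\ z = state 1 psi a) \/
  (exists x psi b a', is_all_fml phi x psi /\ is_update a' a x b /\
     z = state 1 psi a').

Definition move (y z : V M) : Prop :=
  exists phi a,
    (y = state 2 phi a /\ (z = state 0 phi a \/ z = state 1 phi a)) \/
    (y = state 1 phi a /\ z = state 0 phi a) \/
    (y = state 0 phi a /\ descent phi a z).

Lemma move2_iff (phi a z : V M) :
  move (state 2 phi a) z <-> z = state 0 phi a \/ z = state 1 phi a.
Proof.
  split.
  - intros (psi & b & [[E H]|[[E H]|[E H]]]);
      apply state_inj in E as (E & <- & <-);
      try discriminate E. exact H.
  - intro H. exists phi, a. auto.
Qed.

Lemma move1_iff (phi a z : V M) :
  move (state 1 phi a) z <-> z = state 0 phi a.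
Proof.
  split.
  - intros (psi & b & [[E H]|[[E H]|[E H]]]);
      apply state_inj in E as (E & <- & <-);
      try discriminate E. exact H.
  - intro H. exists phi, a. auto.
Qed.

Lemma move0_iff (phi a z : V M) :
  move (state 0 phi a) z <-> descent phi a z.
Proof.
  split.
  - intros (psi & b & [[E H]|[[E H]|[E H]]]);
      apply state_inj in E as (E & <- & <-);
      try discriminate E. exact H.
  - intro H. exists phi, a. auto.
Qed.

(** Moves that stay at one formula strip singletons. A descent may add one, which fits because a
    code lies at least two membership steps above its immediate subformulas. *)
Lemma move_rank (y z : V M) : move y z -> rk (first z) ∈ rk (first y).
Proof.
  intros (phi & a & [[-> [->| ->]]|[[-> ->]|[-> H]]]).
  - unfold state. rewrite !first_opair. simpl.
    apply rk_transitive with (a := rk (upair phi phi));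
      apply rk_mem, in_upair; auto.
  - unfold state. rewrite !first_opair. apply rk_mem, in_upair. auto.
  - unfold state. rewrite !first_opair. apply rk_mem, in_upair. auto.
  - destruct H as [(psi & H & ->)|[(Phi & psi & H & Hpsi & ->)|
      (x & psi & b & a' & H & _ & ->)]];
      unfold state; rewrite !first_opair; simpl.
    + apply tagged_iff in H as ->. apply rk_opair_r.
    + apply tagged_iff in H as ->.
      apply rk_transitive with (a := rk (upair (num 4) Phi)).
      * apply rk_mem, in_upair. auto.
      * apply (rk_sing Hpsi). apply in_upair. auto.
    + apply tagged2_iff in H as ->.
      apply rk_transitive with (a := rk (opair x psi)); apply rk_opair_r.
Qed.

(** * Subformulas and their valuations *)

Lemma formula_neg (phi psi d : V M) :
  is_formula phi d -> is_neg_fml phi psi -> is_formula psi d.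
Proof.
  intros [Hd (s & Hs & Hcl)] H. apply tagged_iff in H as ->.
  split; [exact Hd|]. exists s. split; [|exact Hcl].
  destruct (Hcl _ _ Hs) as [(x & y & _ & _ & H)|[(x & y & _ & _ & H)|
    [(x & _ & H)|[(psi' & H & K)|[(Phi & H & _)|(x & psi' & d' & H & _)]]]]];
    (apply tagged2_iff in H || apply tagged_iff in H); try tag_clash.
  apply opair_inj in H as [_ ->]. exact K.
Qed.

Lemma formula_conj (phi Phi psi d : V M) :
  is_formula phi d -> is_conj_fml phi Phi -> psi ∈ Phi -> is_formula psi d.
Proof.
  intros [Hd (s & Hs & Hcl)] H Hpsi. apply tagged_iff in H as ->.
  split; [exact Hd|]. exists s. split; [|exact Hcl].
  destruct (Hcl _ _ Hs) as [(x & y & _ & _ & H)|[(x & y & _ & _ & H)|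
    [(x & _ & H)|[(psi' & H & _)|[(Phi' & H & K)|(x & psi' & d' & H & _)]]]]];
    (apply tagged2_iff in H || apply tagged_iff in H); try tag_clash.
  apply opair_inj in H as [_ ->]. exact (K psi Hpsi).
Qed.

Lemma formula_all (phi x psi d : V M) :
  is_formula phi d -> is_all_fml phi x psi -> is_formula psi (adjoin d x).
Proof.
  intros [Hd (s & Hs & Hcl)] H. apply tagged2_iff in H as ->.
  destruct (Hcl _ _ Hs) as [(u & y & _ & _ & H)|[(u & y & _ & _ & H)|
    [(u & _ & H)|[(psi' & H & _)|[(Phi' & H & _)|
      (u & psi' & d' & H & Hd' & Hc & K)]]]]];
    (apply tagged2_iff in H || apply tagged_iff in H); try tag_clash.
  apply opair_inj in H as [_ H]. apply opair_inj in H as [-> ->].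
  apply is_adjoin_iff in Hd' as ->.
  split; [exact Hc|]. exists s. auto.
Qed.

Lemma is_fun_on_update (a a' d x b : V M) :
  is_fun_on a d -> is_update a' a x b -> is_fun_on a' (adjoin d x).
Proof.
  intros [_ Hd] [Hf Ha']. split; [exact Hf|]. intro y. rewrite in_adjoin. split.
  - intro H. destruct (classic (y = x)) as [->|Hne].
    + exists b. apply Ha'. auto.
    + destruct H as [H|H]; [|contradiction].
      apply Hd in H as [c Hc]. exists c. apply Ha'. auto.
  - intros [c Hc]. apply Ha' in Hc as [[-> _]|[_ Hc]]; auto.
    left. apply Hd. eauto.
Qed.

(** * Tarski's clauses from a winning strategy *)

Section Truth.

Context (A : C M).

Definition false_atom (phi a : V M) : Prop :=
  (exists x y u v, is_eq_fml phi x y /\ app a x u /\ app a y v /\ u <> v) \/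
  (exists x y u v, is_mem_fml phi x y /\ app a x u /\ app a y v /\ ~ u ∈ v) \/
  (exists x u, is_in_fml phi x /\ app a x u /\ ~ u ∈c A).

(** The falsifier is to move at [state 0], so false atoms are his wins. Any other dead end is lost
    for him, in particular an empty conjunction. *)
Definition mover_wins (y : V M) : Prop :=
  exists phi a, y = state 0 phi a /\ false_atom phi a.

Context (P Q : V M -> Prop).
Context (PQ : forall y, P y -> Q y -> False).
Context (Q_move : forall y z, Q y -> move y z -> P z).
Context (P_move : forall y,
  P y -> (exists z, move y z) -> exists z, move y z /\ Q z).
Context (P_end : forall y, P y -> ~ (exists z, move y z) -> mover_wins y).
Context (Q_end : forall y, Q y -> ~ (exists z, move y z) -> ~ mover_wins y).

(** The only move at [state 1] is the pass, so the strategy has to make it. *)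
Lemma P1_Q0 (phi a : V M) : P (state 1 phi a) -> Q (state 0 phi a).
Proof.
  intro H. destruct (P_move H) as (z & Hz & K).
  - exists (state 0 phi a). apply move1_iff. reflexivity.
  - apply move1_iff in Hz as ->. exact K.
Qed.

Lemma Q1_P0 (phi a : V M) : Q (state 1 phi a) -> P (state 0 phi a).
Proof.
  intro H. apply (Q_move H), move1_iff. reflexivity.
Qed.

Context (T : C M).
Context (HT : forall phi a, cpair T phi a <-> valid phi a /\ Q (state 0 phi a)).
Context (decided : forall phi a,
  valid phi a -> P (state 0 phi a) \/ Q (state 0 phi a)).

(** Without a descent the state is a dead end: an owner to move there must face a false atom, an
    opponent to move there cannot. By [decided] one of the two is the case. *)
Lemma truth_atomic (phi a : V M) :
  valid phi a -> ~ (exists z, descent phi a z) ->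
  (cpair T phi a <-> ~ false_atom phi a).
Proof.
  intros Hv Hn.
  assert (Hn' : ~ exists z, move (state 0 phi a) z).
  { intros [z Hz]. apply move0_iff in Hz. eauto. }
  rewrite HT. split.
  - intros [_ H] K. apply (Q_end H Hn'). exists phi, a. auto.
  - intro K. split; [exact Hv|]. destruct (decided Hv) as [H|H]; [|exact H].
    destruct (P_end H Hn') as (psi & b & E & F).
    apply state_inj in E as (_ & <- & <-). contradiction.
Qed.

(** The single move swaps the falsifier. If the opponent is to move at [phi], he may reach [psi]
    with the owner as falsifier, which excludes truth of [psi]; if the owner is, his strategy makes
    the opponent falsify [psi]. *)
Lemma truth_neg (phi psi a : V M) :
  valid phi a -> is_neg_fml phi psi -> (cpair T phi a <-> ~ cpair T psi a).
Proof.
  intros Hv Hphi.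
  assert (Hm : move (state 0 phi a) (state 0 psi a)).
  { apply move0_iff. left. eauto. }
  rewrite !HT. split.
  - intros [_ H] [_ K]. exact (PQ (Q_move H Hm) K).
  - intro K. split; [exact Hv|]. destruct (decided Hv) as [H|H]; [|exact H].
    destruct K. split.
    + destruct Hv as (d & Hd & Ha). exists d.
      split; [exact (formula_neg Hd Hphi)|exact Ha].
    + destruct (P_move H) as (z & Hz & K); [eauto|].
      apply tagged_iff in Hphi as ->.
      apply move0_iff in Hz as [(psi' & E & ->)|[(Phi & psi' & E & _)|
        (x & psi' & b & a' & E & _)]];
        (apply tagged2_iff in E || apply tagged_iff in E); try tag_clash.
      apply opair_inj in E as [_ ->]. exact K.
Qed.

(** If the opponent is the falsifier, he may attack any conjunct, so all are true. If the owner
    were, his strategy would select a conjunct that he goes on to falsify, contradicting its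
    truth. *)
Lemma truth_conj (phi Phi a : V M) :
  valid phi a -> is_conj_fml phi Phi ->
  (cpair T phi a <-> forall psi, psi ∈ Phi -> cpair T psi a).
Proof.
  intros Hv Hphi. split.
  - intros H psi Hpsi. apply HT in H as [_ H]. apply HT. split.
    + destruct Hv as (d & Hd & Ha). exists d.
      split; [exact (formula_conj Hd Hphi Hpsi)|exact Ha].
    + apply P1_Q0, (Q_move H), move0_iff. right; left. eauto.
  - intro K. apply HT. split; [exact Hv|].
    destruct (decided Hv) as [H|H]; [|exact H]. exfalso.
    apply tagged_iff in Hphi as ->.
    destruct (classic (exists z, move (state 0 (opair (num 4) Phi) a) z))
      as [Hex|Hex].
    + destruct (P_move H Hex) as (z & Hz & L).
      apply move0_iff in Hz as [(psi' & E & ->)|[(Phi' & psi & E & Hpsi & ->)|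
        (x & psi' & b & a' & E & _)]];
        (apply tagged2_iff in E || apply tagged_iff in E); try tag_clash.
      apply opair_inj in E as [_ ->].
      apply (PQ (Q1_P0 L)), HT, K, Hpsi.
    (* Here [Phi] is empty: the owner would be stuck at a formula that is no atom, and lose. *)
    + destruct (P_end H Hex) as (phi & b & E & F).
      apply state_inj in E as (_ & <- & <-).
      destruct F as [(x & y & u & v & E & _)|[(x & y & u & v & E & _)|
        (x & u & E & _)]];
        (apply tagged2_iff in E || apply tagged_iff in E); tag_clash.
Qed.

(** As for conjunctions, with the updates of [a] in the role of the conjuncts; their domain
    [adjoin d x] is the context in which [psi] is a formula. *)
Lemma truth_all (phi x psi a : V M) :
  valid phi a -> is_all_fml phi x psi ->
  (cpair T phi a <-> forall b a', is_update a' a x b -> cpair T psi a').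
Proof.
  intros Hv Hphi. split.
  - intros H b a' Hup. apply HT in H as [_ H]. apply HT. split.
    + destruct Hv as (d & Hd & Ha). exists (adjoin d x).
      split; [exact (formula_all Hd Hphi)|exact (is_fun_on_update Ha Hup)].
    + apply P1_Q0, (Q_move H), move0_iff. right; right.
      exists x, psi, b, a'. auto.
  - intro K. apply HT. split; [exact Hv|].
    destruct (decided Hv) as [H|H]; [|exact H]. exfalso.
    apply tagged2_iff in Hphi as ->.
    destruct (classic (exists z,
      move (state 0 (opair (num 5) (opair x psi)) a) z)) as [Hex|Hex].
    + destruct (P_move H Hex) as (z & Hz & L).
      apply move0_iff in Hz as [(psi' & E & ->)|[(Phi' & psi' & E & Hpsi & ->)|
        (x' & psi' & b & a' & E & Hup & ->)]];
        (apply tagged2_iff in E || apply tagged_iff in E); try tag_clash.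
      apply opair_inj in E as [_ E]. apply opair_inj in E as [-> ->].
      apply (PQ (Q1_P0 L)), HT. exact (K b a' Hup).
    (* An owner stuck at a quantified formula would lose, since the mover wins dead ends at false
       atoms only. *)
    + destruct (P_end H Hex) as (phi & b & E & F).
      apply state_inj in E as (_ & <- & <-).
      destruct F as [(y & z & u & v & E & _)|[(y & z & u & v & E & _)|
        (y & u & E & _)]];
        (apply tagged2_iff in E || apply tagged_iff in E); tag_clash.
Qed.

Lemma truth_predicate :
  (forall p, p ∈c T -> exists phi a, p = opair phi a) ->
  is_truth_predicate A T.
Proof.
  intro HTp. split.
  { intros p Hp. destruct (HTp p Hp) as (phi & a & ->).
    apply cpair_iff, HT in Hp as [(d & Hd & Ha) _]. exists phi, a, d.
    rewrite is_opair_iff. auto. }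
  intros phi a d Hphi Ha.
  assert (Hv : valid phi a) by (exists d; auto).
  (* The tags 0, 1, 2 are those of atoms, while every descent starts from a tag 3, 4 or 5. *)
  assert (Hat : forall k c, k < 3 -> phi = opair (num k) c ->
    (cpair T phi a <-> ~ false_atom phi a)).
  { intros k c Hk ->. apply (truth_atomic Hv).
    intros (z & [(psi & E & _)|[(Phi & psi & E & _)|(x & psi & b & a' & E & _)]]);
      (apply tagged2_iff in E || apply tagged_iff in E);
      apply opair_inj, proj1, num_inj in E; subst k;
      repeat apply le_S_n in Hk; inversion Hk. }
  split; [|split; [|split; [|split; [|split]]]].
  - intros x y u v E Hu Hv'. apply tagged2_iff in E.
    rewrite (Hat 0 _ ltac:(auto) E). subst phi. split.
    + intro K. apply NNPP. intro L. apply K. left. exists x, y, u, v.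
      unfold is_eq_fml. rewrite tagged2_iff. auto.
    + intros -> [(x' & y' & u' & v' & E & Hu' & Hv'' & L)|
        [(x' & y' & u' & v' & E & _)|(x' & u' & E & _)]];
        (apply tagged2_iff in E || apply tagged_iff in E); try tag_clash.
      apply opair_inj in E as [_ E]. apply opair_inj in E as [<- <-].
      apply L. rewrite <- (proj2 (proj1 Ha) _ _ _ Hu Hu').
      exact (proj2 (proj1 Ha) _ _ _ Hv' Hv'').
  - intros x y u v E Hu Hv'. apply tagged2_iff in E.
    rewrite (Hat 1 _ ltac:(auto) E). subst phi. split.
    + intro K. apply NNPP. intro L. apply K. right; left. exists x, y, u, v.
      unfold is_mem_fml. rewrite tagged2_iff. auto.
    + intros Huv [(x' & y' & u' & v' & E & _)|
        [(x' & y' & u' & v' & E & Hu' & Hv'' & L)|(x' & u' & E & _)]];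
        (apply tagged2_iff in E || apply tagged_iff in E); try tag_clash.
      apply opair_inj in E as [_ E]. apply opair_inj in E as [<- <-].
      apply L. rewrite <- (proj2 (proj1 Ha) _ _ _ Hu Hu').
      rewrite <- (proj2 (proj1 Ha) _ _ _ Hv' Hv''). exact Huv.
  - intros x u E Hu. apply tagged_iff in E.
    rewrite (Hat 2 _ ltac:(auto) E). subst phi. split.
    + intro K. apply NNPP. intro L. apply K. right; right. exists x, u.
      unfold is_in_fml. rewrite tagged_iff. auto.
    + intros HuA [(x' & y' & u' & v' & E & _)|
        [(x' & y' & u' & v' & E & _)|(x' & u' & E & Hu' & L)]];
        (apply tagged2_iff in E || apply tagged_iff in E); try tag_clash.
      apply opair_inj in E as [_ <-].
      apply L. rewrite <- (proj2 (proj1 Ha) _ _ _ Hu Hu'). exact HuA.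
  - intros psi. exact (truth_neg Hv).
  - intros Phi. exact (truth_conj Hv).
  - intros x psi. exact (truth_all Hv).
Qed.

End Truth.

Lemma truth_predicate_exists :
  clopen_determinacy_rank_Ord_plus_1 M ->
  forall A : C M, exists T : C M, is_truth_predicate A T.
Proof.
  intros Hdet A.
  destruct (graph_game (Init := opening) (MW := mover_wins A) (Mv := move)
    (lab := fun y => rk (first y)) Hdet)
    as (p & P & Q & HQ & PQ & Q_move & P_move & P_end & Q_end & Hstart);
    [dfn|dfn|dfn|dfn|intro; apply is_ord_rk|exact move_rank|].
  (* Truth is what the owner defends: some conforming play reaches [phi] with his opponent as
     falsifier. *)
  destruct (class_of (P := fun q => exists phi a,
    q = opair phi a /\ valid phi a /\ Q (state 0 phi a))) as [T HT]; [dfn|].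
  exists T. apply (truth_predicate PQ Q_move P_move P_end Q_end).
  - intros phi a. rewrite cpair_iff, HT. split.
    + intros (psi & b & E & H). apply opair_inj in E as [-> ->]. exact H.
    + intro H. exists phi, a. auto.
  - intros phi a Hv.
    assert (Ho : opening (state 2 phi a)) by (exists phi, a; auto).
    destruct p.
    (* If I owned the strategy, II could give either answer to the opening. One puts I to move at
       [state 0 psi b]; after the other, the forced pass of I puts II to move there. *)
    + exfalso. destruct Hstart as (z & (psi & b & _ & ->) & Hz); [eauto|].
      apply (PQ (state 0 psi b)).
      * apply (Q_move _ _ Hz), move2_iff. auto.
      * apply (P1_Q0 P_move), (Q_move _ _ Hz), move2_iff. auto.
    + destruct (P_move _ (Hstart _ Ho)) as (z & Hz & K).
      * exists (state 0 phi a). apply move2_iff. auto.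
      (* Answering with [state 0] defends [phi]; answering with [state 1] makes I pass, so that II
         becomes the falsifier. *)
      * apply move2_iff in Hz as [->| ->]; [auto|].
        left. exact (Q1_P0 Q_move K).
  - intros q Hq. apply HT in Hq as (phi & a & -> & _). eauto.
Qed.

End Development.

Theorem theorem28 :
  forall M : class_structure, GBC M ->
    clopen_determinacy_rank_Ord_plus_1 M ->
    forall A : C M, exists T : C M, is_truth_predicate A T.
Proof.
  exact truth_predicate_exists.
Qed.
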